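(* There exists an absolute constant $C>0$ such that for every tree $T$ on $n$ vertices with maximum degree $\Delta\geq 3$ and every integer $k\geq \Delta+1$, the Glauber dynamics for $k$-edge-colourings of $T$ has mixing time at most $n^{C}$.
   Context: A (proper) $k$-edge-colouring of a graph is a map from its edge set to $[k]=\{1,\dots,k\}$ such that any two edges sharing an endpoint receive different colours. The (discrete-time) Glauber dynamics for $k$-edge-colourings of $T$ is the Markov chain on the set of $k$-edge-colourings of $T$ which, at each step, chooses an edge $e$ of $T$ uniformly at random and a colour $c\in[k]$ uniformly at random, and recolours $e$ with $c$ if no edge sharing an endpoint with $e$ has colour $c$ (otherwise the colouring is unchanged). Its stationary distribution $\pi$ is uniform on the $k$-edge-colourings. The mixing time is $\inf\{t:\max_x d_{TV}(\nu^t_x,\pi)<1/4\}$, where $\nu^t_x$ is the distribution after $t$ steps started from $x$ and $d_{TV}(\nu,\pi)=\frac12\sum_y|\nu(y)-\pi(y)|$. *)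

(* Defs.v *)
From HB Require Import structures.
From mathcomp Require Import all_boot all_order all_algebra.
From mathcomp Require Import Rstruct exp.
Notation R := Rdefinitions.R.
Set Implicit Arguments. Unset Strict Implicit. Unset Printing Implicit Defensive.
Import Order.TTheory GRing.Theory Num.Theory.
Local Open Scope ring_scope.

Section Graph.
Variables (n : nat) (T : rel 'I_n).

Definition simple_graph := symmetric T /\ irreflexive T.

Definition acyclic := forall c : seq 'I_n, ucycle T c -> (size c < 3)%N : Prop.
Definition connected := forall x y : 'I_n, connect T x y.
Definition is_tree := [/\ simple_graph, connected & acyclic].

Definition deg (x : 'I_n) : nat := #|[set y | T x y]|.
Definition max_degree : nat := \max_(x : 'I_n) deg x.

Definition edge_set : {set {set 'I_n}} :=
  [set e | [exists x, exists y, T x y && (e == [set x; y])]].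
Definition edge := {e : {set 'I_n} | e \in edge_set}.

Variable k : nat.
Definition col := {ffun edge -> 'I_k}.

Definition edges_adj (e f : edge) : bool := (e != f) && (val e :&: val f != set0).

Definition proper (c : col) : bool :=
  [forall e, forall f, edges_adj e f ==> (c e != c f)].

Definition recolour (x : col) (e : edge) (a : 'I_k) : col :=
  [ffun f => if f == e then a else x f].

Definition glauber_move (x : col) (e : edge) (a : 'I_k) : col :=
  if [forall f, edges_adj f e ==> (x f != a)] then recolour x e a else x.

Definition glauber_P (x y : col) : R :=
  (#|[set p : edge * 'I_k | glauber_move x p.1 p.2 == y]|%:R)
  / ((#|{: edge}| * k)%:R).

(* distribution after t steps from x (as a function on all colour maps;
   it is supported on proper colourings when x is proper) *)
Fixpoint nu (x : col) (t : nat) : col -> R :=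
  match t with
  | 0 => fun y => (y == x)%:R
  | t'.+1 => fun y => \sum_(z : col) nu x t' z * glauber_P z y
  end.

Definition pi_unif (y : col) : R := (proper y)%:R / (#|[set c : col | proper c]|)%:R.

Definition dTV (mu p : col -> R) : R := 2^-1 * \sum_(y : col) `|mu y - p y|.

Definition mixed_at (t : nat) : Prop :=
  forall x : col, proper x -> dTV (nu x t) pi_unif < 4^-1.

(* mixing time = inf {t | mixed_at t} <= b  (inf over nat, +oo if empty) *)
Definition mixing_time_le (b : R) : Prop :=
  exists t : nat, mixed_at t /\ t%:R <= b.

End Graph.

(* Main.v *)
(* Reveal the colours of the tree from the root downwards. Kempe changes pointing
   away from the root are bijections between the colourings giving a revealed edge
   two different colours, so the variance of a function is at most the sum of its
   squared increments along such changes. A Kempe change is in turn simulated by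
   polynomially many single-edge updates: during the change exactly one edge of the
   chain is blank, and a blank edge is represented by any proper colouring obtained
   by giving it a colour free at its top and pushing the conflict down to the end of
   a path along missing colours. Each intermediate colouring arises from the initial
   one by shifting colours along at most five descending paths, which bounds the
   congestion and yields a Poincare inequality polynomial in n and k. The factor
   log k lost when passing to total variation is harmless for k < 8n, and for larger k
   the identity coupling contracts the Hamming distance. *)
Require Import Defs.
From HB Require Import structures.
From mathcomp Require Import all_boot all_order all_algebra.
From mathcomp Require Import Rstruct exp.
From mathcomp Require Import boolp.
From mathcomp Require Import ring lra zify.
Notation R := Rdefinitions.R.
Set Implicit Arguments. Unset Strict Implicit. Unset Printing Implicit Defensive.
Import Order.TTheory GRing.Theory Num.Theory.
Local Open Scope ring_scope.

(** * Single-edge updates and walks confined to a set of colourings *)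

Section Glauber.
Local Open Scope nat_scope.
Variables (E : finType) (k : nat) (adj : rel E).
Notation coloring := {ffun E -> 'I_k}.
Implicit Types (x y : coloring) (e f : E) (a b : 'I_k).

Definition recol x e a : coloring := [ffun f => if f == e then a else x f].

Definition update x e a : coloring :=
  if [forall f, adj f e ==> (x f != a)] then recol x e a else x.

Definition proper_col x : bool :=
  [forall e, forall f, adj e f ==> (x e != x f)].

Lemma recolE x e a f : recol x e a f = if f == e then a else x f.
Proof. by rewrite ffunE. Qed.

Lemma recol_eq x e a : recol x e a e = a.
Proof. by rewrite ffunE eqxx. Qed.

Lemma recol_neq x e a f : f != e -> recol x e a f = x f.
Proof. by rewrite ffunE => /negPf->. Qed.

Lemma recol_id x e : recol x e (x e) = x.
Proof. by apply/ffunP=> f; rewrite ffunE; case: eqP => [->|]. Qed.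

Lemma recol_recol x e a b : recol (recol x e a) e b = recol x e b.
Proof. by apply/ffunP=> f; rewrite !ffunE; case: eqP. Qed.

Lemma proper_colP x : reflect (forall e f, adj e f -> x e <> x f) (proper_col x).
Proof.
apply: (iffP forallP) => [H e f aef|H e].
  by move/forallP: (H e) => /(_ f); rewrite aef => /eqP.
by apply/forallP=> f; apply/implyP=> /H /eqP.
Qed.

Hypothesis adj_sym : symmetric adj.
Hypothesis adj_irr : irreflexive adj.

Lemma recol_proper x e a : proper_col x ->
  (forall f, adj f e -> x f <> a) -> proper_col (recol x e a).
Proof.
move/proper_colP=> px H; apply/proper_colP=> f g afg; rewrite !ffunE.
case: (f =P e) => [fe|_]; case: (g =P e) => [ge|_].
- by move: afg; rewrite fe ge adj_irr.
- by move=> E1; apply: (H g) => //; rewrite adj_sym -fe.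
- by apply: H; rewrite -ge.
- exact: px.
Qed.

Lemma update_proper x e a : proper_col x -> proper_col (update x e a).
Proof.
rewrite /update => px; case: forallP => // H; apply: recol_proper => // f afe.
by move: (H f); rewrite afe => /eqP.
Qed.

Lemma update_recol x e a : (forall f, adj f e -> x f <> a) -> update x e a = recol x e a.
Proof.
move=> H; rewrite /update; case: forallP => // -[] f.
by apply/implyP=> /H /eqP.
Qed.

Lemma update_self x e : proper_col x -> update x e (x e) = x.
Proof.
move/proper_colP=> px; rewrite update_recol ?recol_id // => f afe; exact: px.
Qed.

Lemma update_back x e a : proper_col x -> update (update x e a) e (x e) = x.
Proof.
move=> px; rewrite {2}/update; case: ifP => _; last exact: update_self.
rewrite update_recol ?recol_recol ?recol_id // => f afe.
rewrite recol_neq; first by move/proper_colP: px => /(_ _ _ afe).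
by apply: contraTneq afe => ->; rewrite adj_irr.
Qed.

Lemma update_other x e a f : f != e -> update x e a f = x f.
Proof. by rewrite /update; case: ifP => // _; apply: recol_neq. Qed.

(** Symmetry is built in so that a walk can be assembled from both ends; as updates of proper
    colourings are reversible, [walk_connect] turns it into plain connectivity. *)
Inductive walk (C : coloring -> Prop) : coloring -> coloring -> Prop :=
| walk_refl x : walk C x x
| walk_update x e a : C x -> C (update x e a) -> proper_col x -> walk C x (update x e a)
| walk_sym x y : walk C x y -> walk C y x
| walk_trans x y z : walk C x y -> walk C y z -> walk C x z.

Lemma walk_sub (C C' : coloring -> Prop) x y :
  (forall z, C z -> C' z) -> walk C x y -> walk C' x y.
Proof.
move=> sub; elim=> [z|z e a Cz Cm pz|z t _|z t u _ W1 _ W2].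
- exact: walk_refl.
- by apply: walk_update => //; apply: sub.
- exact: walk_sym.
- exact: walk_trans W1 W2.
Qed.

Lemma walk_recol (C : coloring -> Prop) x e a : C x -> C (recol x e a) -> proper_col x ->
  (forall f, adj f e -> x f <> a) -> walk C x (recol x e a).
Proof. by move=> Cx Cy px H; rewrite -(update_recol H) in Cy *; apply: walk_update. Qed.

Definition update_rel (c : pred coloring) : rel coloring :=
  fun x y => [&& c x, c y, proper_col x, proper_col y & [exists e, exists a, y == update x e a]].

Lemma update_rel_sym c : symmetric (update_rel c).
Proof.
suff H x y : update_rel c x y -> update_rel c y x by move=> x y; apply/idP/idP; apply: H.
case/and5P=> cx cy px py /existsP[e /existsP[a /eqP Ey]]; apply/and5P; split=> //.
by apply/existsP; exists e; apply/existsP; exists (x e); rewrite Ey update_back.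
Qed.

Lemma walk_connect (C : coloring -> Prop) (c : pred coloring) x y :
  (forall z, C z -> c z) -> walk C x y -> connect (update_rel c) x y.
Proof.
move=> sub; elim=> [z|z e a Cz Cm pz|z t _|z t u _ W1 _ W2].
- exact: connect0.
- apply: connect1; rewrite /update_rel !sub ?pz ?update_proper //=.
  by apply/existsP; exists e; apply/existsP; exists a.
- by rewrite (sym_connect_sym (@update_rel_sym c)).
- exact: connect_trans W1 W2.
Qed.

End Glauber.

Lemma card_bigcup_leq (I T : finType) (P : pred I) (A : I -> {set T}) (m : nat) :
  (forall i, P i -> #|A i| <= m)%N -> (#|\bigcup_(i | P i) A i| <= #|P| * m)%N.
Proof.
move=> Am; rewrite -sum_nat_const; elim/big_rec2: _ => [|i n B Pi IH]; first by rewrite cards0.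
by apply: leq_trans (leq_card_setU _ _) _; rewrite leq_add ?Am.
Qed.

(** * Edges of a rooted tree, and shifts of colours down its branches *)

Section Tree.
Local Open Scope nat_scope.
Variables (E V : finType) (k : nat) (top bot : E -> V) (dep : V -> nat) (H : nat).
Notation coloring := {ffun E -> 'I_k}.
Implicit Types (x : coloring) (e f g q : E) (a b c y z : 'I_k) (h : nat).

Definition star (v : V) (f : E) := (top f == v) || (bot f == v).
Definition child q g := top g == bot q.
Definition tadj e f := (e != f) && [|| top e == top f, top e == bot f | bot e == top f].
Definition desc := connect child.

Hypothesis bot_inj : injective bot.
Hypothesis dep_bot : forall e, dep (bot e) = (dep (top e)).+1.
Hypothesis dep_le : forall v, dep v <= H.
Hypothesis star_lt : forall v, #|star v| < k.

Lemma tadj_sym : symmetric tadj.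
Proof.
move=> e f; rewrite /tadj eq_sym (eq_sym (top e)) (eq_sym (top e)) (eq_sym (bot e)).
by case: (_ == _) => //=; case: (_ == _) => //=; rewrite orbC.
Qed.

Lemma tadj_irr : irreflexive tadj.
Proof. by move=> e; rewrite /tadj eqxx. Qed.

Lemma dep_child q g : child q g -> dep (bot g) = (dep (bot q)).+1.
Proof. by move=> /eqP qg; rewrite dep_bot qg. Qed.

Lemma dep_desc q g : desc q g -> (g = q) \/ dep (bot q) < dep (bot g).
Proof.
case/connectP=> s; elim: s q => [|f s IH] q /=; first by left.
case/andP=> qf fs Eg; right; case: (IH _ fs Eg) => [->|].
  by rewrite (dep_child qf).
by rewrite (dep_child qf); apply: ltn_trans.
Qed.

Lemma child_neq q g : child q g -> g != q.
Proof. by move/dep_child=> D; apply/eqP=> E1; move: D; rewrite E1 => /eqP; rewrite ltn_eqF. Qed.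

Lemma child_ndesc q g : child q g -> ~~ desc g q.
Proof.
move=> qg; apply/negP=> /dep_desc[E1|]; first by move: (child_neq qg); rewrite E1 eqxx.
by rewrite (dep_child qg) ltnNge leqnSn.
Qed.

Lemma desc_refl q : desc q q. Proof. exact: connect0. Qed.

Lemma desc_child q g : child q g -> desc q g. Proof. exact: connect1. Qed.

Lemma desc_trans q g f : desc q g -> desc g f -> desc q f.
Proof. exact: connect_trans. Qed.

Lemma desc_last q f : desc q f -> f = q \/ exists2 p, desc q p & child p f.
Proof.
case/connectP=> s; elim/last_ind: s => [|s p _] /=; first by left.
rewrite rcons_path last_rcons => /andP[qs sp] ->; right.
by exists (last q s) => //; apply/connectP; exists s.
Qed.

(** Climbing from [f], both chains pass through the same parent edge because [bot] is injective, so
    they arrive together at the common depth. *)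
Lemma desc_disjoint g g' f : dep (bot g) = dep (bot g') -> desc g f -> desc g' f -> g = g'.
Proof.
move=> D; have [n] := ubnP (dep (bot f)); elim: n f => // n IH f ltf gf g'f.
case: (desc_last gf) => [E1|[p gp pf]].
  case: (dep_desc g'f) => [<- //|].
  by rewrite E1 D ltnn.
case: (desc_last g'f) => [E1|[p' g'p' p'f]].
  case: (dep_desc gf) => [<- //|].
  by rewrite E1 -D ltnn.
have Ep : p = p' by apply: bot_inj; rewrite -(eqP pf) -(eqP p'f).
rewrite -{}Ep in g'p'; apply: IH gp g'p'.
by move: ltf; rewrite (dep_child pf) ltnS.
Qed.

Lemma desc_sib g g' f : g != g' -> top g = top g' -> desc g f -> ~~ desc g' f.
Proof.
move=> gg' Et gf; apply/negP=> g'f; case/eqP: gg'.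
by apply: desc_disjoint gf g'f; rewrite !dep_bot Et.
Qed.

Lemma star_top_ndesc q f : f != q -> star (top q) f -> ~~ desc q f.
Proof.
move=> fq sf; apply/negP=> /dep_desc[E1|]; first by rewrite E1 eqxx in fq.
case/orP: sf => /eqP sf; last by rewrite sf dep_bot ltnNge leqnSn.
by rewrite !dep_bot sf ltnn.
Qed.

Lemma star_bot q f : star (bot q) f = (f == q) || child q f.
Proof. by rewrite /star /child orbC (inj_eq bot_inj). Qed.

Lemma tadjE f q : tadj f q = (f != q) && (star (top q) f || child q f).
Proof.
rewrite /tadj /star /child; case: (f =P q) => //= _.
by case: (top f == top q) => //=; rewrite orbC.
Qed.

(* The colour of q itself may clash at top q: q is regarded as blank there, and
   x q only records a colour unused by the children of q. *)
Definition okat x q := (forall e f, tadj e f -> e != q -> f != q -> x e <> x f) /\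
  (forall g, child q g -> x g <> x q).
Definition free x q y := forall f, f != q -> star (top q) f -> x f <> y.
Definition unused x q y := forall g, child q g -> x g <> y.

Lemma proper_okat x q : proper_col tadj x -> okat x q.
Proof.
move/proper_colP=> px; split=> [e f aef _ _|g qg]; first exact: px.
by apply: px; rewrite tadjE child_neq ?qg ?orbT.
Qed.

Lemma proper_free x q : proper_col tadj x -> free x q (x q).
Proof. by move/proper_colP=> px f fq sf; apply: px; rewrite tadjE fq sf. Qed.

Lemma okat_recol x q y : okat x q -> free x q y -> unused x q y -> proper_col tadj (recol x q y).
Proof.
move=> [ok1 ok2] fr un; apply/proper_colP=> e f aef; rewrite !recolE.
case: (e =P q) => [Ee|/eqP ne]; case: (f =P q) => [Ef|/eqP nf].
- by move: aef; rewrite Ee Ef tadj_irr.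
- move: aef; rewrite Ee tadj_sym tadjE nf /= => /orP[sf|cf] /esym.
    exact: fr.
  exact: un.
- move: aef; rewrite Ef tadjE ne /= => /orP[sf|cf].
    exact: fr.
  exact: un.
- exact: ok1.
Qed.

Lemma free_unused_adj x q y : free x q y -> unused x q y -> forall f, tadj f q -> x f <> y.
Proof. by move=> fr un f; rewrite tadjE => /andP[nf /orP[]]; [apply: fr|apply: un]. Qed.

Lemma child_top q g f : child q g -> star (top g) f = (f == q) || child q f.
Proof. by move=> /eqP ->; rewrite star_bot. Qed.

Lemma sib_adj x q g f : okat x q -> child q g -> child q f -> f != g -> x f <> x g.
Proof.
move=> [ok1 _] qg qf fg; apply: ok1; rewrite ?child_neq //.
by rewrite tadjE fg (child_top _ qg) qf orbT.
Qed.

(** The blank moves from [q] to its child [g]. The clash between [q] and [g] is ignored once [g] is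
    blank, and all other edges at either end of [q] avoid [y]. *)
Lemma okat_down x q y g : okat x q -> free x q y -> child q g -> x g = y ->
  okat (recol x q y) g.
Proof.
move=> ok fr qg Eg; have [ok1 ok2] := ok; split=> [e f aef eg fg|f gf].
  rewrite !recolE.
  case: (e =P q) => [Ee|/eqP ne]; case: (f =P q) => [Ef|/eqP nf].
  - by move: aef; rewrite Ee Ef tadj_irr.
  - move: aef; rewrite Ee tadj_sym tadjE nf /= => /orP[sf|cf] /esym.
      exact: fr.
    by rewrite -Eg; apply: sib_adj cf fg.
  - move: aef; rewrite Ef tadjE ne /= => /orP[sf|cf].
      exact: fr.
    by rewrite -Eg; apply: sib_adj cf eg.
  - exact: ok1.
have nfq : f != q.
  by apply/eqP=> E1; move: (dep_child gf); rewrite E1 (dep_child qg) => /eqP; rewrite ltn_eqF.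
rewrite (recol_neq _ _ nfq) (recol_neq _ _ (child_neq qg)).
apply: ok1 => //; last exact: child_neq.
by rewrite tadjE child_neq // gf orbT.
Qed.

Lemma free_down x q y g z : child q g -> z <> y -> (forall f, child q f -> f != g -> x f <> z) ->
  free (recol x q y) g z.
Proof.
move=> qg zy un f fg; rewrite (child_top _ qg) recolE; case: eqP => [_ _|_ /=].
  by move/esym.
by move=> qf; apply: un.
Qed.

(** [h] bounds the number of levels below [q] and is the fuel of [flip]; with no fuel left, [q] has
    no child. *)
Definition hgt q h := H <= dep (bot q) + h.

Lemma hgt0 q g : hgt q 0 -> ~~ child q g.
Proof.
rewrite /hgt addn0 => Hq; apply/negP=> /dep_child D.
by move: (leq_trans (dep_le (bot g)) Hq); rewrite D ltnn.
Qed.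

Lemma hgtS q g h : child q g -> hgt q h.+1 -> hgt g h.
Proof. by rewrite /hgt => /dep_child->; rewrite addSnnS. Qed.

(* flip r gives q the colour y and repairs the conflicts downwards; r chooses
   the next colour. With r := home this is the Kempe change of colours x q and y
   below q, a bijection; with r := mu it uses a colour missing at bot q, so that
   single-edge updates performed from the bottom up realise it. *)
Section Flip.
Variable r : coloring -> E -> 'I_k.
Hypothesis r_loc : forall x x' q, (forall f, (f == q) || child q f -> x f = x' f) -> r x q = r x' q.
Hypothesis r_unused : forall x q, okat x q -> unused x q (r x q).

Fixpoint flip h q y x : coloring :=
  if h is h'.+1 then
    if [pick g | child q g && (x g == y)] is Some g then flip h' g (r x q) (recol x q y)
    else recol x q y
  else recol x q y.

Variant flip_spec h q y x : coloring -> Prop :=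
| FlipStop of unused x q y : flip_spec h q y x (recol x q y)
| FlipGo g h' of h = h'.+1 & child q g & x g = y & hgt g h' :
   flip_spec h q y x (flip h' g (r x q) (recol x q y)).

Lemma flipP h q y x : hgt q h -> flip_spec h q y x (flip h q y x).
Proof.
case: h => [|h] hq /=; first by apply: FlipStop => g qg; case/negP: (hgt0 g hq).
case: pickP => [g /andP[qg /eqP Eg]|N].
  by apply: FlipGo => //; apply: hgtS hq.
by apply: FlipStop => g qg Eg; move: (N g); rewrite qg Eg eqxx.
Qed.

Lemma flip_stop h q y x : unused x q y -> flip h q y x = recol x q y.
Proof.
by case: h => //= h un; case: pickP => // g /andP[/un qg /eqP].
Qed.

Lemma flip_go h q y x g : child q g -> x g = y -> (forall f, child q f -> f != g -> x f <> x g) ->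
  flip h.+1 q y x = flip h g (r x q) (recol x q y).
Proof.
move=> qg Eg un /=; case: pickP => [f /andP[qf /eqP Ef]|/(_ g)]; last by rewrite qg Eg eqxx.
by case: (f =P g) => [-> //|/eqP /(un _ qf)]; rewrite Ef Eg.
Qed.

Lemma flip_out h q y x f : ~~ desc q f -> flip h q y x f = x f.
Proof.
elim: h q y x => [|h IH] q y x nf /=.
  by rewrite recol_neq //; apply: contraNneq nf => ->; apply: desc_refl.
have fq : f != q by apply: contraNneq nf => ->; apply: desc_refl.
case: pickP => [g /andP[qg _]|_]; last by rewrite recol_neq.
rewrite IH ?recol_neq //; apply: contra nf; apply: desc_trans; exact: desc_child.
Qed.

Lemma flip_in h q y x x' : (forall f, desc q f -> x' f = x f) ->
  forall f, desc q f -> flip h q y x' f = flip h q y x f.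
Proof.
elim: h q y x x' => [|h IH] q y x x' Ex f qf /=; first by rewrite !recolE Ex.
have -> : [pick g | child q g && (x' g == y)] = [pick g | child q g && (x g == y)].
  by apply: eq_pick => g /=; case qg: (child q g) => //=; rewrite Ex // desc_child.
case: pickP => [g /andP[qg _]|_]; last by rewrite !recolE Ex.
rewrite (@r_loc x' x); last first.
  by move=> p /orP[/eqP->|/desc_child]; [apply: Ex; apply: desc_refl|apply: Ex].
case gf: (desc g f).
  by apply: IH => // p gp; rewrite !recolE Ex // (desc_trans _ gp) // desc_child.
by rewrite !flip_out ?gf // !recolE Ex.
Qed.

Lemma flip_agree h q y x x' f : (forall f, desc q f -> x' f = x f) ->
  flip h q y x' f = if desc q f then flip h q y x f else x' f.
Proof. by move=> Ex; case: ifPn => [|nf]; [apply: flip_in|apply: flip_out]. Qed.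

Lemma flip_recol h q y x e a : ~~ desc q e ->
  flip h q y (recol x e a) = recol (flip h q y x) e a.
Proof.
move=> ne; apply/ffunP=> f.
rewrite (@flip_agree _ _ _ x); last first.
  by move=> p qp; rewrite recol_neq //; apply: contraNneq ne => <-.
rewrite !recolE; case: ifP => [qf|qf]; last by rewrite flip_out ?qf.
by case: (f =P e) qf ne => [-> ->|].
Qed.

Lemma flip_top h q y x : hgt q h -> flip h q y x q = y.
Proof.
move=> hq; case: flipP => // [_|g h' _ qg _ _]; first by rewrite recol_eq.
by rewrite flip_out ?recol_eq // child_ndesc.
Qed.

(** The invariant is that only one edge is blank and its intended colour is free at its top;
    [r_unused] passes this on to the child in conflict. *)
Lemma flip_proper h q y x : hgt q h -> okat x q -> free x q y ->
  proper_col tadj (flip h q y x).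
Proof.
elim: h q y x => [|h IH] q y x hq ok fr.
  by case: flipP => // un; apply: okat_recol.
case: flipP => // [un|g _ [<-] qg Eg hg]; first exact: okat_recol.
apply: IH => //; first exact: okat_down.
apply: free_down => // [E1|f qf _]; last exact: r_unused.
by move: (r_unused ok qg); rewrite E1 Eg.
Qed.

(** This forgets [r]: a flip of a given [x] is determined by the path travelled and the last colour,
    which makes flips countable. *)
Fixpoint shift q s y x : coloring :=
  if s is g :: s' then shift g s' y (recol x q (x g)) else recol x q y.

Lemma flip_shift h q y x : exists s z, path child q s /\ flip h q y x = shift q s z x.
Proof.
elim: h q y x => [|h IH] q y x /=; first by exists [::], y.
case: pickP => [g /andP[qg /eqP Eg]|_]; last by exists [::], y.
have [s [z [gs ->]]] := IH g (r x q) (recol x q y).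
by exists (g :: s), z; rewrite /= qg Eg.
Qed.

End Flip.

(** The flips act on disjoint subtrees and, by locality of [r] and [r'], read nothing outside
    them. *)
Lemma flip_comm r r' h h' g g' y z x :
  (forall x x' q, (forall f, (f == q) || child q f -> x f = x' f) -> r x q = r x' q) ->
  (forall x x' q, (forall f, (f == q) || child q f -> x f = x' f) -> r' x q = r' x' q) ->
  g != g' -> top g = top g' ->
  flip r h g y (flip r' h' g' z x) = flip r' h' g' z (flip r h g y x).
Proof.
move=> rl rl' ng Et; apply/ffunP=> f.
have d1 p : desc g p -> ~~ desc g' p by apply: desc_sib.
have d2 p : desc g' p -> ~~ desc g p by apply: desc_sib; rewrite 1?eq_sym.
rewrite (@flip_agree r rl _ _ _ x); last by move=> p /d1; apply: flip_out.
rewrite [RHS](@flip_agree r' rl' _ _ _ x); last by move=> p /d2; apply: flip_out.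
case: ifP => [gf|gf]; first by rewrite (negPf (d1 _ gf)).
by case: ifP => [//|g'f]; rewrite !flip_out ?gf ?g'f.
Qed.

Lemma flip_sib r h q g f z x : child q g -> child q f -> f != g -> flip r h g z x f = x f.
Proof.
move=> qg qf fg; apply: flip_out; apply: (@desc_sib f g) => //.
  by rewrite (eqP qg) (eqP qf).
exact: desc_refl.
Qed.

Lemma flip_above r h q g f z x : child q g -> f != q -> star (top q) f -> flip r h g z x f = x f.
Proof.
move=> qg fq sf; apply: flip_out; apply: contra (star_top_ndesc fq sf).
by apply: desc_trans; apply: desc_child.
Qed.

Lemma flip_parent r h q g z x : child q g -> flip r h g z x q = x q.
Proof. by move=> qg; apply/flip_out/child_ndesc. Qed.

(** * Missing colours, and Kempe changes realised by single-edge updates *)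

Definition miss x v c := [forall f, star v f ==> (x f != c)].
Definition miss_col c0 x v := odflt c0 [pick c | miss x v c].
Definition mu x q := miss_col (x q) x (bot q).
Definition home x q := x q.

Lemma missP x v c : reflect (forall f, star v f -> x f <> c) (miss x v c).
Proof.
apply: (iffP forallP) => [M f sf|M f]; first by move: (M f); rewrite sf => /eqP.
by apply/implyP=> /M /eqP.
Qed.

Lemma miss_colP c0 x v f : star v f -> x f <> miss_col c0 x v.
Proof.
rewrite /miss_col; case: pickP => [c /missP|N] /=; first exact.
suff: k <= #|star v| by rewrite leqNgt star_lt.
rewrite -[X in X <= _]card_ord; apply: leq_trans (leq_imset_card x (star v)).
apply/subset_leq_card/subsetP=> c _.
have [//|nc] := boolP (c \in [set x f | f in star v]).
case/missP: (N c) => g sg Eg; case/negP: nc.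
by apply/imsetP; exists g.
Qed.

Lemma miss_col_loc c0 x x' v : (forall f, star v f -> x f = x' f) ->
  miss_col c0 x v = miss_col c0 x' v.
Proof.
move=> Ex; congr (odflt _ _); apply: eq_pick => c.
by apply/eq_forallb => f; case sf: (star v f) => //=; rewrite Ex.
Qed.

Lemma mu_loc x x' q : (forall f, (f == q) || child q f -> x f = x' f) -> mu x q = mu x' q.
Proof.
move=> Ex; rewrite /mu Ex ?eqxx //; apply: miss_col_loc => f.
by rewrite star_bot; apply: Ex.
Qed.

Lemma mu_unused x q : unused x q (mu x q).
Proof. by move=> g qg; apply: miss_colP; rewrite star_bot qg orbT. Qed.

Lemma mu_neq x q : x q <> mu x q.
Proof. by apply: miss_colP; rewrite star_bot eqxx. Qed.

Lemma home_loc x x' q : (forall f, (f == q) || child q f -> x f = x' f) -> home x q = home x' q.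
Proof. by apply; rewrite eqxx. Qed.

Lemma home_unused x q : okat x q -> unused x q (home x q).
Proof. by case. Qed.

Let mu_unused' x q (_ : okat x q) := @mu_unused x q.

(* Every colouring on the walks below is reached from the initial one by a bounded
   number of shifts of colours along descending paths; as a shift is determined by
   polynomially many data in both directions, this bounds the congestion. *)
Definition op1 x w := w = x \/ exists q s y, path child q s /\ w = shift q s y x.
Fixpoint near n x w := if n is n'.+1 then exists2 u, op1 x u & near n' u w else w = x.

Lemma near_refl n x : near n x x.
Proof. by elim: n => //= n IH; exists x => //; left. Qed.

Lemma near_leq m n x w : m <= n -> near m x w -> near n x w.
Proof.
elim: m n x => [|m IH] [|n] x //= mn; first by move=> ->; apply: (near_refl n.+1).
by case=> u ou nu; exists u => //; apply: IH nu.
Qed.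

Lemma near1 x w : op1 x w -> near 1 x w.
Proof. by exists w. Qed.

Lemma op1_flip r h q y x : op1 x (flip r h q y x).
Proof. by right; have [s [z [qs ->]]] := flip_shift r h q y x; exists q, s, z. Qed.

(** The first shift is singled out because a step down to a child lengthens its path ([below_down])
    and leaves the number of shifts unchanged; induction on the height therefore keeps a constant
    bound. *)
Definition below q x w := exists s y, path child q s /\ near 2 (shift q s y x) w.

Lemma below_recol q y x w : near 2 (recol x q y) w -> below q x w.
Proof. by exists [::], y. Qed.

Lemma below_down q g x w : child q g -> below g (recol x q (x g)) w -> below q x w.
Proof. by move=> qg [s [y [gs n]]]; exists (g :: s), y; rewrite /= qg. Qed.

Lemma below_near q x w : below q x w -> near 3 x w.
Proof.
by move=> [s [y [qs n]]]; exists (shift q s y x) => //; right; exists q, s, y.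
Qed.

Notation walk := (walk tadj).
Notation proper_col := (proper_col tadj).

Lemma walk_step (C : coloring -> Prop) x q y : proper_col x -> C x -> C (recol x q y) ->
  free x q y -> unused x q y -> walk C x (recol x q y).
Proof. by move=> px Cx Cy fr un; apply: walk_recol => //; apply: free_unused_adj. Qed.

(** The updates run from the bottom up: a child holding [y] first moves to [mu x q], recursively,
    while [q] keeps its colour, and [q] is updated last. Each state passed is [x] or a single shift
    of [x]. *)
Lemma walk_flip_home h q y x : hgt q h -> proper_col x -> free x q y ->
  walk (op1 x) x (flip mu h q y x).
Proof.
elim: h q y x => [|h IH] q y x hq px fr.
  case: flipP => // un; apply: walk_step => //; first by left.
  by right; exists q, [::], y.
have ox := op1_flip mu h.+1 q y x.
have ok := proper_okat q px.
move: ox; case: flipP => // [un|g _ [<-] qg Eg hg] ox.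
  by apply: walk_step => //; left.
have fg : free x g (mu x q).
  by move=> f _; rewrite (child_top _ qg) -star_bot; apply: miss_colP.
move: ox; rewrite flip_recol ?child_ndesc //; last exact: mu_loc.
move=> ox.
apply: walk_trans (IH _ _ _ hg px fg) _; apply: walk_step => //.
- by apply: flip_proper => //; apply: proper_okat.
- exact: op1_flip.
- by move=> f fq sf; rewrite (flip_above _ _ _ _ qg) //; apply: fr.
move=> f qf; have [->|fg'] := eqVneq f g.
  by rewrite flip_top // -Eg => /esym; apply: mu_unused.
by rewrite (flip_sib _ _ _ _ qg) // -Eg; apply: sib_adj qf fg'.
Qed.

(* The edge q passes from y1 directly to y2, so that this works even when y1 and
   y2 are the only colours available to q at its top. *)
Definition retarget h := forall q y1 y2 x, hgt q h -> okat x q -> free x q y1 -> free x q y2 ->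
  walk (below q x) (flip mu h q y1 x) (flip mu h q y2 x).

(** While [q] is still coloured [y1], the child [g] that blocks [y2] is moved aside, after which one
    update recolours [q]. The colour [m] given to [g] must therefore differ from [y1]. *)
Lemma retarget_up h q y1 y2 g x : retarget h -> hgt q h.+1 -> okat x q ->
  free x q y1 -> free x q y2 -> unused x q y1 -> child q g -> x g = y2 ->
  walk (below q x) (recol x q y1) (flip mu h g (mu x q) (recol x q y2)).
Proof.
move=> IH hq ok fr1 fr2 un1 qg Eg; have hg := hgtS qg hq.
have p1 := okat_recol ok fr1 un1.
have nd := child_ndesc qg; have muu := @mu_unused x q.
have ey : x q <> y2 by rewrite -Eg => /esym; apply: ok.2.
have my : mu x q <> y2 by rewrite -Eg => /esym; apply: mu_unused.
have step m : m <> y1 -> m <> y2 -> unused x q m ->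
    walk (below q x) (recol x q y1) (flip mu h g m (recol x q y2)).
  move=> my1 my2 mu'.
  have fg : free (recol x q y1) g m by apply: free_down => // f qf _; apply: mu'.
  have := walk_flip_home hg p1 fg.
  move/(walk_sub (C' := below q x)) => W.
  have {}W := W _; apply: walk_trans (W _) _.
    by move=> w /near1 n; apply: (@below_recol _ y1); apply: (@near_leq 1).
  have E2 : flip mu h g m (recol x q y2) = recol (flip mu h g m (recol x q y1)) q y2.
    by rewrite -flip_recol ?recol_recol //; apply: mu_loc.
  rewrite E2; apply: walk_step.
  - by apply: flip_proper => //; apply: proper_okat.
  - apply: (@below_recol _ y1); apply: (@near_leq 1) => //; apply: near1; exact: op1_flip.
  - rewrite -E2; apply: (@below_recol _ y2); apply: (@near_leq 1) => //; apply: near1.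
    exact: op1_flip.
  - by move=> f fq sf; rewrite (flip_above _ _ _ _ qg) ?recol_neq //; apply: fr2.
  - move=> f qf; have [->|fg'] := eqVneq f g; first by rewrite flip_top.
    rewrite (flip_sib _ _ _ _ qg) // recol_neq ?child_neq // -Eg; exact: sib_adj qf fg'.
(* If [mu x q] is [y1], the child [g] is parked at [x q] and sent on to [mu x q] only after [q] has
   left [y1]. *)
have [E1|/eqP n1] := eqVneq (mu x q) y1; last exact: step.
apply: walk_trans (step (x q) _ _ _) _ => //.
- by rewrite -E1; apply: mu_neq.
- exact: ok.2.
apply: (walk_sub (C := below g (recol x q y2))).
  by rewrite -Eg => w; apply: below_down.
apply: IH => //.
- exact: okat_down.
- by apply: free_down => // f qf _; apply: ok.2.
- by apply: free_down => // f qf _; apply: mu_unused.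
Qed.

(** Each target colour is held by a child. Here [g1] goes from [m] to [eta] ([t1]), [g2] goes to [m]
    ([t2]), [q] passes from [y1] to [y2] ([t3]), and [g1] returns to [y1] ([t4]). Two distinct
    parking colours allow both children to be aside at once. *)
Lemma retarget_across h q y1 y2 g1 g2 x : retarget h -> hgt q h.+1 -> okat x q ->
  free x q y1 -> free x q y2 -> child q g1 -> child q g2 -> g1 != g2 -> x g1 = y1 -> x g2 = y2 ->
  walk (below q x) (flip mu h g1 (mu x q) (recol x q y1)) (flip mu h g2 (mu x q) (recol x q y2)).
Proof.
move=> IH hq ok fr1 fr2 qg1 qg2 ng E1 E2; have hg1 := hgtS qg1 hq; have hg2 := hgtS qg2 hq.
have ng' : g2 != g1 by rewrite eq_sym.
have muu := @mu_unused x q; have etau := ok.2; have me := @mu_neq x q.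
set m := mu x q in muu me *; set eta := x q in etau me *.
have em1 : eta <> y1 by rewrite -E1 => /esym; apply: etau.
have em2 : eta <> y2 by rewrite -E2 => /esym; apply: etau.
have mm1 : m <> y1 by rewrite -E1 => /esym; apply: muu.
have mm2 : m <> y2 by rewrite -E2 => /esym; apply: muu.
set x1 := recol x q y1; set x2 := recol x q y2.
have ok1 : okat x1 g1 by apply: okat_down.
have ok2 : okat x2 g2 by apply: okat_down.
have fe1 : free x1 g1 eta by apply: free_down => // f qf _; apply: etau.
set t1 := flip mu h g1 eta x1; set t4 := flip mu h g2 m x2.
have pt1 : proper_col t1 by apply: flip_proper.
have pt4 : proper_col t4.
  by apply: flip_proper => //; apply: free_down => // f qf _; apply: muu.
have t1f f : child q f -> f != g1 -> t1 f = x f.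
  by move=> qf nf; rewrite /t1 (flip_sib _ _ _ _ qg1) // recol_neq // child_neq.
have t4f f : child q f -> f != g2 -> t4 f = x f.
  by move=> qf nf; rewrite /t4 (flip_sib _ _ _ _ qg2) // recol_neq // child_neq.
have t1q : t1 q = y1 by rewrite /t1 flip_parent // recol_eq.
have t4q : t4 q = y2 by rewrite /t4 flip_parent // recol_eq.
have ft1 : free t1 g2 m.
  move=> f nf; rewrite (child_top _ qg2) => /orP[/eqP->|qf]; first by rewrite t1q => /esym.
  have [->|nf1] := eqVneq f g1; first by rewrite /t1 flip_top.
  by rewrite t1f //; apply: muu.
have ft4 : free t4 g1 eta.
  move=> f nf; rewrite (child_top _ qg1) => /orP[/eqP->|qf]; first by rewrite t4q => /esym.
  have [->|nf1] := eqVneq f g2; first by rewrite /t4 flip_top // => /esym.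
  by rewrite t4f //; apply: etau.
set t2 := flip mu h g2 m t1; set t3 := flip mu h g1 eta t4.
have E3 : t3 = recol t2 q y2.
  rewrite /t3 /t4 flip_comm //; [|exact: mu_loc|exact: mu_loc|by rewrite (eqP qg1) (eqP qg2)].
  rewrite /t2 -flip_recol ?child_ndesc //; last exact: mu_loc.
  by rewrite /t1 -flip_recol ?child_ndesc ?recol_recol //; apply: mu_loc.
apply: (@walk_trans _ _ _ _ _ t1).
  apply: (walk_sub (C := below g1 x1)); first by rewrite /x1 -E1 => w; apply: below_down.
  by apply: IH => //; apply: free_down => // f qf _; apply: muu.
have n1 w : op1 t1 w -> below q x w.
  move=> o; apply: (@below_recol _ y1); exists t1; first exact: op1_flip.
  exact: near1.
have n4 w : op1 t4 w -> below q x w.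
  move=> o; apply: (@below_recol _ y2); exists t4; first exact: op1_flip.
  exact: near1.
apply: (@walk_trans _ _ _ _ _ t2); first by apply: walk_sub n1 _; apply: walk_flip_home.
(* The last leg is walked backwards, from [t4] to [t3], so that [walk_flip_home] applies. *)
apply: (@walk_trans _ _ _ _ _ t3); last first.
  by apply: walk_sym; apply: walk_sub n4 _; apply: walk_flip_home.
rewrite E3; apply: walk_step.
- by apply: flip_proper => //; apply: proper_okat.
- by apply: n1; apply: op1_flip.
- by rewrite -E3; apply: n4; apply: op1_flip.
- move=> f nf sf; rewrite /t2 (flip_above _ _ _ _ qg2) // /t1 (flip_above _ _ _ _ qg1) //.
  by rewrite recol_neq //; apply: fr2.
move=> f qf; have [->|nf2] := eqVneq f g2; first by rewrite /t2 flip_top.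
rewrite /t2 (flip_sib _ _ _ _ qg2) //.
have [->|nf1] := eqVneq f g1; first by rewrite /t1 flip_top.
by rewrite t1f // -E2; apply: sib_adj ok qg2 qf nf2.
Qed.

Lemma retargetP h : retarget h.
Proof.
elim: h => [|h IH] q y1 y2 x hq ok fr1 fr2.
  have un y : unused x q y by move=> g qg; case/negP: (hgt0 g hq).
  rewrite /= -(recol_recol x q y1 y2); apply: walk_step.
  - exact: okat_recol.
  - exact/below_recol/near_refl.
  - by rewrite recol_recol; apply/below_recol/near_refl.
  - by move=> f nf sf; rewrite recol_neq //; apply: fr2.
  - by move=> f qf; rewrite recol_neq ?child_neq //; apply: un.
have [->|ny] := eqVneq y1 y2; first exact: walk_refl.
case: (flipP mu y1 x hq) => [un1|g1 _ [<-] qg1 E1 hg1];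
  case: (flipP mu y2 x hq) => [un2|g2 _ [<-] qg2 E2 hg2].
- rewrite -(recol_recol x q y1 y2); apply: walk_step.
  + exact: okat_recol.
  + exact/below_recol/near_refl.
  + by rewrite recol_recol; apply/below_recol/near_refl.
  + by move=> f nf sf; rewrite recol_neq //; apply: fr2.
  + by move=> f qf; rewrite recol_neq ?child_neq //; apply: un2.
- exact: retarget_up.
- by apply: walk_sym; apply: retarget_up.
- by apply: retarget_across => //; apply: contra_neq ny => Eg; rewrite -E1 -E2 Eg.
Qed.

(* Once q has colour c, its child g of colour c is the blank edge of the Kempe
   chain, and flip mu h q c x is a representative of exactly that state. *)
Lemma walk_kempe_below h q y c x : hgt q h -> okat x q -> free x q y -> free x q c ->
  walk (below q x) (flip mu h q y x) (flip home h q c x).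
Proof.
elim: h q y c x => [|h IH] q y c x hq ok fy fc; first exact: (retargetP hq).
apply: walk_trans (retargetP hq ok fy fc) _.
case: (flipP home c x hq) => [un|g _ [<-] qg Eg hg].
  by rewrite flip_stop //; apply: walk_refl.
rewrite (@flip_go _ _ _ _ _ g) // => [|f qf fg]; last exact: sib_adj qf fg.
apply: (walk_sub (C := below g (recol x q c))); first by rewrite -Eg => w; apply: below_down.
apply: IH => //.
- exact: okat_down.
- apply: free_down => // [E1|f qf _]; last exact: mu_unused.
  by apply: (@mu_unused x q g qg); rewrite Eg E1.
- apply: free_down => // [E1|f qf _]; last exact: ok.2.
  by apply: (ok.2 _ qg); rewrite Eg -E1.
Qed.

(** The change back retraces the same chain: at each level the child now in conflict is the one that
    received the colour its parent gave up. *)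
Lemma kempe_back h q c x : hgt q h -> proper_col x -> c != x q ->
  flip home h q (x q) (flip home h q c x) = x.
Proof.
move=> hq px; have ok := proper_okat q px.
elim: h q c hq ok => [|h IH] q c hq ok nc; first by rewrite /= recol_recol recol_id.
case: (flipP home c x hq) => [un|g _ [<-] qg Eg hg].
  rewrite flip_stop ?recol_recol ?recol_id // => g qg.
  by rewrite recol_neq ?child_neq //; apply: ok.2.
set t := flip home h g _ _.
have nd := child_ndesc qg.
have Et : t = recol (flip home h g (x q) x) q c by rewrite -flip_recol //; apply: home_loc.
have tg : t g = x q by rewrite /t flip_top.
have tq : t q = c by rewrite Et recol_eq.
rewrite (@flip_go _ _ _ _ _ g) // => [|f qf fg]; last first.
  rewrite tg /t (flip_sib _ _ _ _ qg) // recol_neq ?child_neq //; exact: ok.2.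
rewrite /home tq Et recol_recol.
have -> : recol (flip home h g (x q) x) q (x q) = flip home h g (x q) x.
  by rewrite -flip_recol ?recol_id //; apply: home_loc.
rewrite -Eg; apply: IH => //; first exact: proper_okat.
by apply/eqP=> /esym; apply: ok.2.
Qed.

(** * Kempe changes and exchanges of colours at a vertex *)

Definition kempe q c x := flip home H q c x.

Let hgtH q : hgt q H. Proof. exact: leq_addl. Qed.

Lemma kempe_proper q c x : proper_col x -> free x q c -> proper_col (kempe q c x).
Proof.
by move=> px fc; apply: flip_proper => //; [exact: home_unused|exact: proper_okat].
Qed.

Lemma kempe_at q c x : kempe q c x q = c.
Proof. by rewrite /kempe flip_top. Qed.

Lemma kempe_out q c x f : ~~ desc q f -> kempe q c x f = x f.
Proof. exact: flip_out. Qed.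

Lemma kempe_top q c x f : star (top q) f -> f != q -> kempe q c x f = x f.
Proof. by move=> sf fq; apply/kempe_out/star_top_ndesc. Qed.

Lemma kempeK q c x : proper_col x -> c != x q -> kempe q (x q) (kempe q c x) = x.
Proof. by move=> px nc; apply: kempe_back. Qed.

Lemma walk_kempe q c x : proper_col x -> free x q c -> walk (near 3 x) x (kempe q c x).
Proof.
move=> px fc; have ok := proper_okat q px; apply: walk_sub (@below_near q x) _.
(* [x] is the representative of the state with [q] blank whose target is the colour [q] already
   has. *)
have Ex : flip mu H q (x q) x = x by rewrite flip_stop ?recol_id //; apply: ok.2.
by rewrite -{2}Ex; apply: walk_kempe_below => //; apply: proper_free.
Qed.

(* When a sibling g of e has colour c, the colours of e and g are exchanged
   through a colour missing at their top. *)
Definition swap e c x :=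
  if x e == c then x else
  if [pick g | [&& g != e, star (top e) g & x g == c]] is Some g then
    if top g == top e then
      kempe e c (kempe g (x e) (kempe e (miss_col (x e) x (top e)) x))
    else x
  else kempe e c x.

Lemma star_top e : star (top e) e. Proof. by rewrite /star eqxx. Qed.

Lemma star_inj x v e f : proper_col x -> star v e -> star v f -> x e = x f -> e = f.
Proof.
move=> px se sf Exy; apply/eqP; apply: contraPT Exy => nef.
move/proper_colP: px; apply; rewrite /tadj nef /=.
case/orP: se sf => /eqP se /orP[/eqP sf|/eqP sf]; rewrite se sf ?eqxx ?orbT //.
by move: nef; rewrite (bot_inj (etrans se (esym sf))) eqxx.
Qed.

Section SiblingSwap.
Variables (x : coloring) (e g : E) (c : 'I_k).
Hypotheses (px : proper_col x) (ge : g != e) (tge : top g = top e) (xg : x g = c) (xe : x e <> c).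
Let m := miss_col (x e) x (top e).
Let x1 := kempe e m x.
Let x2 := kempe g (x e) x1.
Let x3 := kempe e c x2.

Let sg : star (top e) g. Proof. by rewrite /star tge eqxx. Qed.
Let eg : e != g. Proof. by rewrite eq_sym. Qed.
Let mf f : star (top e) f -> x f <> m. Proof. exact: miss_colP. Qed.
Let f1 : free x e m. Proof. by move=> f _; apply: mf. Qed.
Let p1 : proper_col x1. Proof. exact: kempe_proper. Qed.
Let x1e : x1 e = m. Proof. exact: kempe_at. Qed.
Let x1f f : star (top e) f -> f != e -> x1 f = x f. Proof. exact: kempe_top. Qed.
Let f2 : free x1 g (x e).
Proof.
move=> f fg; rewrite tge => sf; have [->|fe] := eqVneq f e.
  by rewrite x1e => /esym; apply: mf; apply: star_top.
by rewrite x1f // => /(star_inj px sf (star_top e)) E1; rewrite E1 eqxx in fe.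
Qed.
Let p2 : proper_col x2. Proof. exact: kempe_proper. Qed.
Let x2g : x2 g = x e. Proof. exact: kempe_at. Qed.
Let x2f f : star (top e) f -> f != g -> x2 f = x1 f.
Proof. by move=> sf fg; apply: kempe_top; rewrite ?tge. Qed.
Let x2e : x2 e = m. Proof. by rewrite x2f ?star_top. Qed.
Let f3 : free x2 e c.
Proof.
move=> f fe sf; have [->|fg] := eqVneq f g; first by rewrite x2g.
by rewrite x2f // x1f // -xg => /(star_inj px sf sg) E1; rewrite E1 eqxx in fg.
Qed.
Let p3 : proper_col x3. Proof. exact: kempe_proper. Qed.
Let x3f f : star (top e) f -> f != e -> x3 f = x2 f. Proof. exact: kempe_top. Qed.

Lemma sib_swap_proper : proper_col x3. Proof. exact: p3. Qed.

(** Two shifts lead to [x2], and the walk for the third Kempe change uses three more, hence 5. *)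
Lemma sib_swap_walk : walk (near 5 x) x x3.
Proof.
have o1 : op1 x x1 by apply: op1_flip.
have o2 : op1 x1 x2 by apply: op1_flip.
apply: walk_trans (_ : walk _ x x1) _.
  by apply: walk_sub (walk_kempe px f1) => w; apply: near_leq.
apply: walk_trans (_ : walk _ x1 x2) _.
  apply: walk_sub (walk_kempe p1 f2) => w n; apply: (@near_leq 4) => //.
  by exists x1.
apply: walk_sub (walk_kempe p2 f3) => w n; exists x1 => //; exists x2 => //.
Qed.

(** The set of colours present at [top e] is the same before and after, so the same auxiliary colour
    [m] is chosen again and the three Kempe changes are undone in reverse order. *)
Lemma sib_swapK : swap e (x e) x3 = x.
Proof.
have x3e : x3 e = c by apply: kempe_at.
have x3g : x3 g = x e by rewrite x3f.
rewrite /swap x3e; case: eqP => [E1|_]; first by case: xe.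
case: pickP => [f /and3P[fe sf /eqP Ef]|/(_ g)]; last by rewrite ge sg x3g eqxx.
rewrite (@star_inj x3 (top e) f g) // ?x3g // tge eqxx.
have -> : miss_col c x3 (top e) = m.
  have E1 : [pick b | miss x3 (top e) b] = [pick b | miss x (top e) b].
    apply: eq_pick => b; apply/missP/missP => M h sh.
      have [->|he] := eqVneq h e; first by rewrite -x3g; apply: M.
      have [->|hg] := eqVneq h g; first by rewrite xg -x3e; apply: M; apply: star_top.
      by rewrite -x1f // -x2f // -x3f //; apply: M.
    have [->|he] := eqVneq h e; first by rewrite x3e -xg; apply: M.
    have [->|hg] := eqVneq h g; first by rewrite x3g; apply: M; apply: star_top.
    by rewrite x3f // x2f // x1f //; apply: M.
  (* The two sides have different defaults, [c] and [x e], so it must be checked that no default is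
     taken. *)
  have : m != x e by apply/eqP => /esym; apply: mf; apply: star_top.
  rewrite /m /miss_col E1; case: pickP => //=; by rewrite eqxx.
have cm : c != m by apply/eqP; rewrite -xg; apply: mf.
have -> : kempe e m x3 = x2 by rewrite -x2e kempeK // x2e.
have -> : kempe g c x2 = x1.
  have x1g : x1 g = c by rewrite x1f.
  by rewrite -x1g kempeK // x1g; apply/eqP.
by rewrite kempeK //; apply/eqP => /esym; apply: mf; apply: star_top.
Qed.

End SiblingSwap.

(** When the parent edge holds [c], the exchange is declared to be the identity; [swap_at] and
    [swapK] rule this case out because the parent is then revealed. *)
Variant swap_spec e c x : coloring -> Prop :=
| SwapId of x e = c : swap_spec e c x x
| SwapFree of c != x e & free x e c : swap_spec e c x (kempe e c x)
| SwapSib g of g != e & top g = top e & x g = c & x e <> c : swap_spec e c x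
    (kempe e c (kempe g (x e) (kempe e (miss_col (x e) x (top e)) x)))
| SwapParent g of child g e & x g = c : swap_spec e c x x.

Lemma swapP e c x : swap_spec e c x (swap e c x).
Proof.
rewrite /swap; case: eqP => [|/eqP ne]; first exact: SwapId.
case: pickP => [g /and3P[ge sg /eqP xg]|N].
  case: eqP sg => [tge|ntg] sg; first by apply: SwapSib => //; apply/eqP.
  by apply: SwapParent xg; case/orP: sg => /eqP; rewrite // /child => ->.
apply: SwapFree; first by rewrite eq_sym.
by move=> f fe sf xf; move: (N f); rewrite fe sf xf eqxx.
Qed.

Lemma swap_proper e c x : proper_col x -> proper_col (swap e c x).
Proof.
move=> px; case: swapP => // [ne fr|g ge tg xg xe]; first exact: kempe_proper.
exact: sib_swap_proper xg xe.
Qed.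

Lemma swap_walk e c x : proper_col x -> walk (near 5 x) x (swap e c x).
Proof.
move=> px; case: swapP => [_|ne fr|g ge tg xg xe|g _ _]; try exact: walk_refl.
  by apply: walk_sub (walk_kempe px fr) => w; apply: near_leq.
exact: sib_swap_walk xg xe.
Qed.

Section Fixed.
Variable F : pred E.
Hypothesis F_up : forall p g, child p g -> F g -> F p.

Lemma desc_fixed q f : ~~ F q -> desc q f -> ~~ F f.
Proof.
move=> nq /connectP[s]; elim: s q nq => [|g s IH] q nq /=; first by move=> _ ->.
by case/andP=> qg gs Ef; apply: IH gs Ef; apply: contra nq; apply: F_up qg.
Qed.

(** [F] stands for the revealed edges. Every Kempe change involved starts at an unrevealed edge, and
    all descendants of such an edge are unrevealed. *)
Lemma swap_fixed e c x f : ~~ F e -> (forall f, F f -> star (top e) f -> x f <> c) -> F f ->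
  swap e c x f = x f.
Proof.
move=> ne nc Ff.
have nd q : ~~ F q -> ~~ desc q f by move=> nq; apply: contraL Ff; apply: desc_fixed.
case: swapP => // [_ _|g ge tg xg xe]; first by rewrite kempe_out ?nd.
have ng : ~~ F g by apply/negP=> Fg; apply: (nc g) => //; rewrite /star tg eqxx.
by rewrite !kempe_out ?nd.
Qed.

Lemma swap_at e c x : ~~ F e -> (forall p, child p e -> F p) ->
  (forall f, F f -> star (top e) f -> x f <> c) -> swap e c x e = c.
Proof.
move=> ne up nc; case: swapP => // [_ _|g _ _ _ _|g ge xg]; rewrite ?kempe_at //.
by case: (nc g) => //; [apply: up|rewrite /star (eqP ge) eqxx orbT].
Qed.

Lemma swapK e c x : proper_col x -> ~~ F e -> (forall p, child p e -> F p) ->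
  (forall f, F f -> star (top e) f -> x f <> c) -> swap e (x e) (swap e c x) = x.
Proof.
move=> px ne up nc; case: (swapP e c x) => [_|nc' fr|g ge tg xg xe|g ge xg].
- by rewrite /swap eqxx.
- case: (swapP e (x e)) => [E1|ne' fr'|g ge tg xg xe|g ge xg].
  + by case/eqP: nc'; rewrite -E1 kempe_at.
  + exact: kempeK.
  + have sg : star (top e) g by rewrite /star tg eqxx.
    move: xg; rewrite kempe_top // => /(star_inj px sg (star_top e)) E1.
    by rewrite E1 eqxx in ge.
  + have sg : star (top e) g by rewrite /star (eqP ge) eqxx orbT.
    have ge' : g != e by rewrite eq_sym child_neq.
    move: xg; rewrite kempe_top // => /(star_inj px sg (star_top e)) E1.
    by rewrite E1 eqxx in ge'.
- exact: sib_swapK.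
- by case: (nc g) => //; [apply: up|rewrite /star (eqP ge) eqxx orbT].
Qed.

End Fixed.

(** * Counting shifts and their preimages *)

Section Counting.

(** Climbs from [z] to [p] with fuel [n]; it shows that a descending path is determined by its two
    ends. *)
Fixpoint route n (p z : E) : seq E :=
  if z == p then [::] else
  if n is n'.+1 then
    if [pick f | bot f == top z] is Some f then rcons (route n' p f) z else [::]
  else [::].

Lemma dep_path p s : path child p s -> dep (bot (last p s)) = dep (bot p) + size s.
Proof.
elim: s p => [|g s IH] p /=; first by rewrite addn0.
by case/andP=> pg /IH ->; rewrite (dep_child pg) addSnnS.
Qed.

Lemma route_path n (p : E) s : path child p s -> size s <= n -> route n p (last p s) = s.
Proof.
elim/last_ind: s n => [|s z IH] n; first by case: n => [|n] _ _ /=; rewrite eqxx.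
move=> ps; have D := dep_path ps; move: ps D; rewrite rcons_path last_rcons size_rcons.
move=> /andP[ps sz] D; case: n => // n; rewrite ltnS => sn /=.
case: eqP => [E1|_]; first by move/eqP: D; rewrite E1 -[X in X == _]addn0 eqn_add2l.
case: pickP => [f /eqP Ef|/(_ (last p s))]; last by rewrite (eqP sz) eqxx.
have -> : f = last p s by apply: bot_inj; rewrite Ef (eqP sz).
by rewrite IH.
Qed.

Lemma path_uniq p s : path child p s -> uniq (p :: s).
Proof.
move=> ps; apply: (@map_uniq _ _ (dep \o bot)).
apply: (sorted_uniq ltn_trans ltnn).
elim: s p ps => //= g s IH p /andP[pg gs].
by rewrite (IH g gs) andbT /= (dep_child pg).
Qed.

(** Each colour moved along the path can be read off one edge higher in the result. Only the colour
    of [p] is overwritten, which is why it has to be given. *)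
Lemma shift_inj p s y x x' : uniq (p :: s) -> x p = x' p -> shift p s y x = shift p s y x' -> x = x'.
Proof.
elim: s p x x' => [|g s IH] p x x' /=.
  move=> _ Ep /ffunP Es; apply/ffunP=> f; move: (Es f); rewrite !recolE.
  by case: eqP => // ->.
case/andP; rewrite inE negb_or => /andP[pg ps] ugs Ep Es.
have out t q u w f : f \notin q :: t -> shift q t u w f = w f.
  elim: t q w => [|q' t IHt] q w /=; rewrite inE; first by move=> /recol_neq->.
  by rewrite negb_or => /andP[fq ft]; rewrite IHt // recol_neq.
have Egg : x g = x' g.
  have := congr1 (fun w : coloring => w p) Es.
  by rewrite !out ?inE ?negb_or ?pg // !recol_eq.
rewrite Egg in Es; have /ffunP Er : recol x p (x' g) = recol x' p (x' g).
  apply: IH ugs _ Es; by rewrite !recolE Egg.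
apply/ffunP=> f; move: (Er f); rewrite !recolE; by case: eqP => // ->.
Qed.

Definition op_set x : {set coloring} :=
  x |: [set shift c.1.1 (route H c.1.1 c.1.2) c.2 x
         | c in [pred c : E * E * 'I_k | uniq (c.1.1 :: route H c.1.1 c.1.2)]].

Lemma op1_set x w : op1 x w -> w \in op_set x.
Proof.
case=> [->|[q [s [y [qs ->]]]]]; rewrite !inE ?eqxx //; apply/orP; right.
have Er : route H q (last q s) = s.
  apply: route_path => //; apply: leq_trans (dep_le (bot (last q s))).
  by rewrite dep_path // leq_addl.
apply/imsetP; exists (q, last q s, y); rewrite ?inE /= Er //.
exact: path_uniq.
Qed.

(** One factor [k] is for the new colour at the end of the path, the other for the lost colour at
    its start, needed for preimages; the 1 accounts for the trivial shift. *)
Let M := 1 + #|E| * #|E| * k * k.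

Lemma card_op_set x : #|op_set x| <= M.
Proof.
rewrite /op_set; apply: leq_trans (leq_card_setU _ _) _; rewrite cards1 leq_add2l.
apply: leq_trans (leq_imset_card _ _) _; apply: leq_trans (max_card _) _.
rewrite !card_prod card_ord -[X in X <= _]muln1; case: k => [|k'] //.
  by rewrite !muln0.
by rewrite leq_mul2l orbT.
Qed.

Lemma card_op_pre w : #|[set x | w \in op_set x]| <= M.
Proof.
pose A (c : E * E * 'I_k * 'I_k) : {set coloring} :=
  [set x : coloring | [&& uniq (c.1.1.1 :: route H c.1.1.1 c.1.1.2), x c.1.1.1 == c.2 &
             shift c.1.1.1 (route H c.1.1.1 c.1.1.2) c.1.2 x == w]].
have sub : [set x | w \in op_set x] \subset w |: \bigcup_c A c.
  apply/subsetP=> x; rewrite !inE => /orP[/eqP->|/imsetP[[[p z] y]]]; first by rewrite eqxx.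
  rewrite inE => /= u Ew; apply/orP; right; apply/bigcupP.
  by exists (p, z, y, x p) => //; rewrite /A inE /= u Ew !eqxx.
apply: leq_trans (subset_leq_card sub) _; apply: leq_trans (leq_card_setU _ _) _.
have A1 (i : E * E * 'I_k * 'I_k) : xpredT i -> #|A i| <= 1.
  move=> _; case: i => [[[p z] y] a]; apply/card_le1_eqP => x' x.
  rewrite /A !inE /= => /and3P[_ /eqP xa' /eqP xw'] /and3P[u /eqP xa /eqP xw].
  exact: (@shift_inj p (route H p z) y x x') u (etrans xa (esym xa')) (etrans xw (esym xw')).
rewrite cards1 leq_add2l; apply: leq_trans (card_bigcup_leq A1) _.
by rewrite muln1 (leq_trans (max_card _)) // !card_prod card_ord.
Qed.

Fixpoint near_set n x : {set coloring} :=
  if n is n'.+1 then \bigcup_(u in op_set x) near_set n' u else [set x].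

Lemma near_setP n x w : near n x w -> w \in near_set n x.
Proof.
elim: n x => [|n IH] x /=; first by move=> ->; rewrite inE.
by case=> u /op1_set ou /IH nu; apply/bigcupP; exists u.
Qed.

Lemma card_near_set n x : #|near_set n x| <= M ^ n.
Proof.
elim: n x => [|n IH] x /=; first by rewrite cards1.
apply: leq_trans (card_bigcup_leq (m := M ^ n) _) _ => //.
by rewrite expnS leq_mul2r card_op_set orbT.
Qed.

Lemma card_near_pre n w : #|[set x | w \in near_set n x]| <= M ^ n.
Proof.
elim: n w => [|n IH] w /=.
  have -> : [set x | w \in [set x]] = [set w] by apply/setP=> x; rewrite !inE eq_sym.
  by rewrite cards1.
have -> : [set x | w \in \bigcup_(u in op_set x) near_set n u] =
    \bigcup_(u in [set u | w \in near_set n u]) [set x | u \in op_set x].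
  apply/setP=> x; rewrite inE; apply/bigcupP/bigcupP => -[u H1 H2]; exists u;
    by move: H1 H2; rewrite !inE.
apply: leq_trans (card_bigcup_leq (m := M) _) _ => [u _|]; first exact: card_op_pre.
by rewrite expnSr leq_mul2r IH orbT.
Qed.

Lemma swap_connect e c x : proper_col x ->
  connect (update_rel tadj [pred w | w \in near_set 5 x]) x (swap e c x).
Proof.
move=> px; apply: walk_connect (swap_walk e c px); [exact: tadj_sym|exact: tadj_irr|].
exact: near_setP.
Qed.

End Counting.

End Tree.

(** * Variance over finite sets and its decomposition along fibres *)

Section Variance.
Variables (K : realFieldType) (T : finType).
Implicit Types (A X : {set T}) (f g : T -> K).

Lemma sum_sqr_diff A g :
  \sum_(x in A) \sum_(y in A) (g x - g y) ^+ 2 =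
  2 * (#|A|%:R * \sum_(x in A) g x ^+ 2 - (\sum_(x in A) g x) ^+ 2).
Proof.
have inner x : \sum_(y in A) (g x - g y) ^+ 2 =
    #|A|%:R * g x ^+ 2 + \sum_(y in A) g y ^+ 2 - 2 * g x * \sum_(y in A) g y.
  rewrite (eq_bigr (fun y => g x ^+ 2 + (g y ^+ 2 - 2 * g x * g y))) => [|y _]; last by ring.
  by rewrite big_split /= sumrB sumr_const -mulr_sumr -[_ *+ #|A|]mulr_natl addrA.
under eq_bigr => x _ do rewrite inner.
rewrite sumrB big_split /= -mulr_sumr sumr_const -mulr_suml -mulr_sumr -[_ *+ #|A|]mulr_natl; ring.
Qed.

Lemma sqr_sum_leq A g : (\sum_(x in A) g x) ^+ 2 <= #|A|%:R * \sum_(x in A) g x ^+ 2.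
Proof.
have : 0 <= \sum_(x in A) \sum_(y in A) (g x - g y) ^+ 2.
  by apply: sumr_ge0 => x _; apply: sumr_ge0 => y _; apply: sqr_ge0.
by rewrite sum_sqr_diff pmulr_rge0 ?ltr0n // subr_ge0.
Qed.

End Variance.

Section VarianceFibre.
Variables (K : realFieldType) (T : finType).
Implicit Types (X : {set T}) (f : T -> K).

(** Not normalised: this is [#|X|] times the variance of [f] under the uniform distribution on
    [X]. *)
Definition var f X := \sum_(x in X) f x ^+ 2 - (\sum_(x in X) f x) ^+ 2 / #|X|%:R.

Lemma var_le1 f X : (#|X| <= 1)%N -> var f X = 0.
Proof.
rewrite leq_eqVlt ltnS leqn0 => /orP[/cards1P[x ->]|/eqP/cards0_eq ->]; rewrite /var.
  by rewrite !big_set1 cards1 divr1 subrr.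
by rewrite !big_set0 expr0n mul0r subrr.
Qed.

(* The fibres of p are in bijection through phi, so they all weigh the same and
   the variance of the fibre means is a sum of squared differences along phi. *)
Lemma var_fibre (I : finType) (X : {set T}) (B : {set I}) (p : T -> I) (phi : I -> T -> T) f :
  (forall x, x \in X -> p x \in B) ->
  (forall x b, x \in X -> b \in B -> [/\ phi b x \in X, p (phi b x) = b & phi (p x) (phi b x) = x]) ->
  var f X <= \sum_(b in B) var f [set x in X | p x == b] +
             \sum_(b in B) \sum_(x in X) (f x - f (phi b x)) ^+ 2.
Proof.
move=> pB phiP; have [X0|[x0 x0X]] := set_0Vmem X.
  rewrite [var f X]var_le1; last by rewrite X0 cards0.
  rewrite big1 ?add0r => [|b _]; last first.
    by apply: var_le1; rewrite leqW // leqn0 cards_eq0 -subset0 -X0; apply/subsetP=> x; rewrite inE => /andP[].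
  by apply: sumr_ge0 => b _; apply: sumr_ge0 => x _; apply: sqr_ge0.
pose Xb b := [set x in X | p x == b].
pose S b := \sum_(x in Xb b) f x.
have phi_in b c x : c \in B -> x \in Xb b -> phi c x \in Xb c.
  by move=> cB; rewrite !inE => /andP[xX _]; have [-> -> _] := phiP x c xX cB; rewrite eqxx.
have phi_can b c x : c \in B -> x \in Xb b -> phi b (phi c x) = x.
  by move=> cB; rewrite !inE => /andP[xX /eqP <-]; have [] := phiP x c xX cB.
have phi_inj b c : c \in B -> {in Xb b &, injective (phi c)}.
  by move=> cB x y xb yb E1; rewrite -(phi_can b c x) // E1 phi_can.
have cle b c : c \in B -> (#|Xb b| <= #|Xb c|)%N.
  move=> cB; rewrite -(card_in_imset (phi_inj b c cB)); apply/subset_leq_card/subsetP=> y.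
  by case/imsetP=> x xb ->; apply: phi_in xb.
pose s := #|Xb (p x0)|.
have b0B := pB _ x0X.
have card_s b : b \in B -> #|Xb b| = s by move=> bB; apply/eqP; rewrite eqn_leq !cle.
have s_gt0 : 0 < s%:R :> K.
  by rewrite ltr0n card_gt0; apply/set0Pn; exists x0; rewrite inE x0X eqxx.
have m_ge1 : 1 <= #|B|%:R :> K.
  by rewrite ler1n card_gt0; apply/set0Pn; exists (p x0).
have sum_part (g : T -> K) : \sum_(x in X) g x = \sum_(b in B) \sum_(x in Xb b) g x.
  rewrite (partition_big p (mem B)) //=; apply: eq_bigr => b _.
  by apply: eq_bigl => x; rewrite !inE.
have card_X : #|X|%:R = #|B|%:R * s%:R :> K.
  transitivity (\sum_(x in X) 1 : K); first by rewrite sumr_const.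
  rewrite sum_part (eq_bigr (fun=> s%:R)) => [|b bB]; last by rewrite sumr_const card_s.
  by rewrite sumr_const mulr_natl.
pose Q := \sum_(b in B) \sum_(x in X) (f x - f (phi b x)) ^+ 2.
have Q_ge0 : 0 <= Q by apply: sumr_ge0 => b _; apply: sumr_ge0 => x _; apply: sqr_ge0.
have reind b c : b \in B -> c \in B -> S c = \sum_(x in Xb b) f (phi c x).
  move=> bB cB; rewrite /S -(big_imset _ (phi_inj b c cB)) /=; apply: eq_bigl => y.
  apply/idP/imsetP => [yc|[x xb ->]]; last exact: phi_in xb.
  exists (phi b y); first exact: phi_in yc.
  by rewrite (phi_can c).
(* With fibres matched through [phi], a difference of two fibre sums is a sum of [s] differences,
   and Cauchy-Schwarz applies. *)
have key : \sum_(b in B) \sum_(c in B) (S b - S c) ^+ 2 <= s%:R * Q.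
  rewrite exchange_big /= mulr_sumr; apply: ler_sum => c cB.
  rewrite sum_part mulr_sumr; apply: ler_sum => b bB.
  rewrite (reind b c) // /S -sumrB -(card_s b bB); exact: sqr_sum_leq.
rewrite sum_sqr_diff in key.
have -> : \sum_(b in B) var f [set x in X | p x == b] =
    \sum_(b in B) (\sum_(x in Xb b) f x ^+ 2 - S b ^+ 2 / s%:R).
  by apply: eq_bigr => b bB; rewrite /var -/(Xb b) card_s.
rewrite -/Q /var card_X !sum_part -/S sumrB -mulr_suml -addrA lerD2l.
set U := \sum_(b in B) S b ^+ 2 in key *; set V := \sum_(b in B) S b in key *.
rewrite addrC -subr_ge0 opprK.
have m_gt0 : 0 < #|B|%:R :> K by apply: lt_le_trans m_ge1.
have -> : Q - U / s%:R + V ^+ 2 / (#|B|%:R * s%:R) =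
    (#|B|%:R * s%:R * Q - (#|B|%:R * U - V ^+ 2)) / (#|B|%:R * s%:R).
  by field; rewrite !gt_eqF.
apply: divr_ge0; last by rewrite mulr_ge0 ?ler0n.
have : s%:R * Q <= #|B|%:R * s%:R * Q.
  by rewrite -mulrA ler_peMl // mulr_ge0 // ltW.
have : 0 <= s%:R * Q by rewrite mulr_ge0 // ltW.
lra.
Qed.

End VarianceFibre.

(** * Dirichlet form and comparison along canonical paths *)

Section Energy.
Variables (K : realFieldType) (E : finType) (k : nat) (adj : rel E).
Notation coloring := {ffun E -> 'I_k}.
Implicit Types (f : coloring -> K) (x y z : coloring).

Definition local_energy f x := \sum_e \sum_a (f x - f (update adj x e a)) ^+ 2.
Definition dirichlet f := \sum_(x | proper_col adj x) local_energy f x.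

Lemma local_energy_ge0 f x : 0 <= local_energy f x.
Proof. by apply: sumr_ge0 => e _; apply: sumr_ge0 => a _; apply: sqr_ge0. Qed.

Lemma path_energy (c : pred coloring) f x p : path (update_rel adj c) x p ->
  (f x - f (last x p)) ^+ 2 <= (size p)%:R * \sum_(z <- belast x p) local_energy f z.
Proof.
elim: p x => [|y p IH] x /=; first by rewrite subrr expr0n mul0r.
case/andP=> /and5P[_ _ _ _ /existsP[e /existsP[a /eqP Ey]]] /IH {}IH; rewrite big_cons.
set S := \sum_(z <- belast y p) _ in IH *.
have S_ge0 : 0 <= S by apply: sumr_ge0 => z _; apply: local_energy_ge0.
have W : (f x - f y) ^+ 2 <= local_energy f x.
  rewrite /local_energy (bigD1 e) //= (bigD1 a) //= -Ey -addrA lerDl.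
  apply: addr_ge0; first by apply: sumr_ge0 => b _; apply: sqr_ge0.
  by apply: sumr_ge0 => e' _; apply: sumr_ge0 => b _; apply: sqr_ge0.
move: W IH; set w := local_energy f x; set u := f x; set v := f y; set l := f _.
case: (size p) => [|m] W IH.
  have : (v - l) ^+ 2 <= 0 by rewrite mul0r in IH.
  rewrite le_eqVlt ltNge sqr_ge0 orbF sqrf_eq0 subr_eq0 => /eqP <-.
  by rewrite mul1r; lra.
(* (s + t)^2 <= (1 + m) s^2 + (1 + 1/m) t^2 *)
set s := u - v in W; set t := v - l in IH.
have -> : u - l = s + t by rewrite /s /t; ring.
set n : K := m.+1%:R in IH; have n_gt0 : 0 < n by rewrite /n ltr0n.
have -> : m.+2%:R = n + 1 by rewrite /n -[m.+2]addn1 natrD.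
have key : n * (s + t) ^+ 2 <= n * ((n + 1) * (w + S)).
  have : 0 <= (n * s - t) ^+ 2 by apply: sqr_ge0.
  have : n * (n + 1) * s ^+ 2 <= n * (n + 1) * w by rewrite ler_pM2l // mulr_gt0 // addr_gt0.
  have : (n + 1) * t ^+ 2 <= (n + 1) * (n * S) by rewrite ler_pM2l // addr_gt0.
  nra.
by rewrite ler_pM2l in key.
Qed.

(** Once loops are removed, the path visits each member of [c] at most once; this bounds both its
    length and the sum of the local energies along it. *)
Lemma connect_energy (c : pred coloring) f x y : connect (update_rel adj c) x y ->
  (f x - f y) ^+ 2 <= #|c|%:R * \sum_(z | proper_col adj z && c z) local_energy f z.
Proof.
case/connectP=> p0 /shortenP[p xp up _ ->]; apply: le_trans (path_energy f xp) _.
have sub z : z \in belast x p -> proper_col adj z && c z.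
  elim: p x xp {up} => //= y' p IH x' /andP[/and5P[cx _ px _ _] yp].
  by rewrite inE => /orP[/eqP->|]; [rewrite px cx|apply: IH].
have ub : uniq (belast x p) by move: up; rewrite lastI rcons_uniq => /andP[].
apply: ler_pM; rewrite ?ler0n ?sumr_ge0 //.
- by move=> z _; apply: local_energy_ge0.
- rewrite ler_nat -(size_belast x p) -(card_uniqP ub).
  by apply/subset_leq_card/subsetP => z /sub /andP[].
rewrite big_uniq //= big_mkcond [X in _ <= X]big_mkcond /=; apply: ler_sum => z _.
case: ifP => [/sub ->//|_]; case: ifP => // _; exact: local_energy_ge0.
Qed.

(** One factor [m] bounds the length of each path, the other the number of starting points whose
    path can visit a given colouring. *)
Lemma connect_energy_sum (c : coloring -> {set coloring}) (g : coloring -> coloring) (m : nat) f :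
  (forall x, proper_col adj x -> connect (update_rel adj [pred w | w \in c x]) x (g x)) ->
  (forall x, #|c x| <= m)%N -> (forall w, #|[set x | w \in c x]| <= m)%N ->
  \sum_(x | proper_col adj x) (f x - f (g x)) ^+ 2 <= m%:R ^+ 2 * dirichlet f.
Proof.
move=> con cm cm'.
have step x : proper_col adj x -> (f x - f (g x)) ^+ 2 <=
    m%:R * \sum_(z | proper_col adj z) (z \in c x)%:R * local_energy f z.
  move=> px; apply: le_trans (connect_energy f (con x px)) _.
  apply: ler_pM; rewrite ?ler0n ?sumr_ge0 //.
  - by move=> z _; apply: local_energy_ge0.
  - by rewrite ler_nat; apply: cm.
  rewrite big_mkcondr /=; apply: ler_sum => z _.
  by case: ifP => _; rewrite ?mul1r ?mul0r.
apply: le_trans (ler_sum _ step) _; rewrite -mulr_sumr expr2 -mulrA ler_wpM2l ?ler0n //.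
rewrite exchange_big /dirichlet mulr_sumr; apply: ler_sum => z _.
rewrite -mulr_suml ler_wpM2r ?local_energy_ge0 //.
rewrite -natr_sum ler_nat; apply: leq_trans (cm' z).
rewrite -sum1dep_card big_mkcond [X in (_ <= X)%N]big_mkcond; apply: leq_sum => x _.
by case: (z \in c x); case: (proper_col adj x).
Qed.

End Energy.

(** * Poincare inequality for colourings of the tree *)

Section Poincare.
Variables (K : realFieldType) (E V : finType) (k : nat) (top bot : E -> V) (dep : V -> nat) (H : nat).
Notation coloring := {ffun E -> 'I_k}.
Implicit Types (x : coloring) (e : E) (c : 'I_k) (f : coloring -> K).

Hypothesis bot_inj : injective bot.
Hypothesis dep_bot : forall e, dep (bot e) = (dep (top e)).+1.
Hypothesis dep_le : forall v, (dep v <= H)%N.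
Hypothesis star_lt : forall v, (#|star top bot v| < k)%N.

Notation proper_col := (proper_col (tadj top bot)).
Notation swap := (swap (k := k) top bot H).

Definition frozen (F : {set E}) (x0 : coloring) : {set coloring} :=
  [set x | proper_col x && [forall e, (e \in F) ==> (x e == x0 e)]].

Lemma frozenP (F : {set E}) x0 x :
  reflect (proper_col x /\ forall e, e \in F -> x e = x0 e) (x \in frozen F x0).
Proof.
rewrite inE; apply: (iffP andP) => -[px Hx]; split=> //.
  by move=> e eF; move/forallP: Hx => /(_ e); rewrite eF => /eqP.
by apply/forallP=> e; apply/implyP=> /Hx ->.
Qed.

(* Edges are revealed from the root downwards: given the revealed colours, the
   next edge is uniform over the colours still free at its top, by swap. *)
Lemma frozen_var (F : {set E}) x0 f :
  (forall p g, child top bot p g -> g \in F -> p \in F) ->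
  var f (frozen F x0) <=
    \sum_(e | e \notin F) \sum_c \sum_(x in frozen F x0) (f x - f (swap e c x)) ^+ 2.
Proof.
have [n] := ubnP #|~: F|; elim: n F x0 => // n IH F x0 ltn up.
have [F0|[e0]] := set_0Vmem (~: F).
  rewrite var_le1; last first.
    apply/card_le1_eqP => x y /frozenP[_ Ex] /frozenP[_ Ey]; apply/ffunP=> e.
    by rewrite Ex ?Ey //; move/setP: F0 => /(_ e); rewrite !inE => /negbFE.
  by apply: sumr_ge0 => e _; apply: sumr_ge0 => c _; apply: sumr_ge0 => x _; apply: sqr_ge0.
(* Least depth guarantees that the parent of [e] is revealed, as [swap_at] and [swapK] require. *)
rewrite inE => e0F; pose e := [arg min_(e < e0 | e \notin F) dep (bot e)].
have [eF mine] : e \notin F /\ forall g, g \notin F -> (dep (bot e) <= dep (bot g))%N.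
  by rewrite /e; case: arg_minnP.
have upe p : child top bot p e -> p \in F.
  move=> pe; apply: contraT => /mine; rewrite (dep_child dep_bot pe) ltnn //.
(* The colours for [e] compatible with the revealed edges at its top; an unrevealed sibling does not
   block a colour, since [swap] can exchange the two. *)
pose B := [set c | [forall g, (g \in F) && star top bot (top e) g ==> (x0 g != c)]].
have BP c : c \in B -> forall x, x \in frozen F x0 ->
    forall g, g \in F -> star top bot (top e) g -> x g <> c.
  rewrite inE => /forallP Bc x /frozenP[_ Ex] g gF sg; rewrite Ex //.
  by move: (Bc g); rewrite gF sg => /eqP.
pose F' := e |: F.
have upF' p g : child top bot p g -> g \in F' -> p \in F'.
  by rewrite !inE => pg /orP[/eqP Eg|/(up _ _ pg) ->]; rewrite ?orbT // upe ?orbT // -Eg.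
apply: (le_trans (@var_fibre _ _ _ (frozen F x0) B (fun x => x e) (swap e) f _ _)).
- move=> x xX; have /frozenP[px Ex] := xX; rewrite inE; apply/forallP=> g.
  apply/implyP=> /andP[gF sg]; rewrite -Ex //; apply/eqP.
  move: eF; apply: contraNnot => /(star_inj bot_inj px sg (star_top _ _ _)) <- //.
- move=> x c xX cB; have /frozenP[px Ex] := xX; have nc := BP c cB x xX.
  split.
  + apply/frozenP; split; first exact: swap_proper.
    by move=> g gF; rewrite -Ex //; exact: (swap_fixed (F := fun g => g \in F) H up eF nc gF).
  + exact: (swap_at (F := fun g => g \in F) dep_bot dep_le eF upe nc).
  + exact: (swapK (F := fun g => g \in F) bot_inj dep_bot dep_le star_lt px eF upe nc).
rewrite (bigD1 e eF) /= [X in X <= _]addrC; apply: lerD.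
  rewrite [X in _ <= X](bigID (mem B)) /= lerDl.
  by apply: sumr_ge0 => c _; apply: sumr_ge0 => x _; apply: sqr_ge0.
have froz c : [set x in frozen F x0 | x e == c] = frozen F' (recol x0 e c).
  apply/setP=> x; rewrite inE; apply/andP/frozenP => [[/frozenP[px Ex] /eqP xe]|[px Ex]].
    split=> // g; rewrite inE recolE in_set1; case: (g =P e) => [->|_] //=; exact: Ex.
  split; last by rewrite Ex ?setU11 // recol_eq.
  apply/frozenP; split=> // g gF.
  have ge : g != e by apply: contraNneq eF => <-.
  by rewrite Ex ?inE ?gF ?orbT // recol_neq.
apply: le_trans (_ : \sum_(c in B) \sum_(e' | (e' \notin F) && (e' != e)) \sum_c'
   \sum_(x in [set x in frozen F x0 | x e == c]) (f x - f (swap e' c' x)) ^+ 2 <= _).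
  apply: ler_sum => c _; rewrite froz; apply: le_trans (IH F' _ _ upF') _.
    move: ltn; rewrite ltnS; apply: leq_trans; rewrite /F' setCU; apply: proper_card.
    apply/properP; split; first exact: subsetIr.
    by exists e; rewrite !inE ?eqxx.
  rewrite le_eqVlt; apply/orP; left; apply/eqP; apply: eq_bigl => g.
  by rewrite !inE negb_or andbC.
rewrite exchange_big /=; apply: ler_sum => g _; rewrite exchange_big /=; apply: ler_sum => c' _.
rewrite (partition_big (fun x : coloring => x e) predT) //= [X in _ <= X](bigID (mem B)) /=.
rewrite -[X in X <= _]addr0; apply: lerD; last first.
  by apply: sumr_ge0 => c _; apply: sumr_ge0 => x _; apply: sqr_ge0.
by apply: ler_sum => c _; rewrite (eq_bigl (fun x => (x \in frozen F x0) && (x e == c))) // => x; rewrite inE.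
Qed.

Definition near_count : nat := (1 + #|E| * #|E| * k * k) ^ 5.
Definition poincare_const : nat := #|E| * k * near_count ^ 2.

Lemma poincare f :
  var f [set x | proper_col x] <= poincare_const%:R * dirichlet (tadj top bot) f.
Proof.
have D_ge0 : 0 <= dirichlet (tadj top bot) f.
  by apply: sumr_ge0 => x _; apply: local_energy_ge0.
have [->|[x0 _]] := set_0Vmem [set x : coloring | proper_col x].
  by rewrite var_le1 ?cards0 // mulr_ge0.
have -> : [set x | proper_col x] = frozen set0 x0.
  apply/setP=> x; rewrite inE; apply/idP/frozenP => [px|[]//].
  by split=> // e; rewrite inE.
apply: le_trans (frozen_var _ _ _) _ => [p g _|]; first by rewrite inE.
have step e c : \sum_(x in frozen set0 x0) (f x - f (swap e c x)) ^+ 2 <=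
    near_count%:R ^+ 2 * dirichlet (tadj top bot) f.
  rewrite (eq_bigl proper_col) => [|x].
    apply: (connect_energy_sum (c := near_set top bot H 5)) => [x px|x|w].
    - exact: swap_connect px.
    - exact: card_near_set.
    - exact: card_near_pre.
  by apply/frozenP/idP => [[]//|px]; split=> // g; rewrite inE.
rewrite /poincare_const; move: near_count step => m step.
apply: le_trans (_ : \sum_(e : E) \sum_(c < k) m%:R ^+ 2 * dirichlet (tadj top bot) f <= _).
  rewrite [X in _ <= X](bigID (fun e => e \notin set0)) /= -[X in X <= _]addr0; apply: lerD.
    by apply: ler_sum => e _; apply: ler_sum => c _.
  by apply: sumr_ge0 => e _; apply: sumr_ge0 => c _; rewrite mulr_ge0 ?sqr_ge0.
rewrite !sumr_const card_ord -mulrnA -[X in X <= _]mulr_natl mulrA -natrX -natrM.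
by rewrite (mulnC k) lexx.
Qed.

End Poincare.

(** With g = 1/m, (1 - g)(1 + g) <= 1 reduces the claim to (1 + g)^m >= 2, which is Bernoulli's
    inequality. *)
Lemma expr_half (K : realFieldType) (m : nat) : (0 < m)%N -> (1 - m%:R^-1) ^+ m <= 2^-1 :> K.
Proof.
move=> m0; have m0' : 0 < m%:R :> K by rewrite ltr0n.
set g := m%:R^-1; have g0 : 0 < g by rewrite invr_gt0.
have g1 : g <= 1 by rewrite invf_le1 // ler1n.
have bern n : 1 + g *+ n <= (1 + g) ^+ n.
  elim: n => [|n IH]; first by rewrite mulr0n addr0 expr0.
  rewrite exprS; apply: le_trans (_ : (1 + g) * (1 + g *+ n) <= _); last first.
    by rewrite ler_pM2l // addr_gt0.
  by rewrite mulrDl mul1r mulrDr mulr1 mulrS -!addrA lerD2l addrCA lerD2l lerDl mulr_ge0 ?mulrn_wge0 // ltW.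
have := bern m; rewrite -[g *+ m]mulr_natl divff ?gt_eqF // => two.
have p2 : 0 < (1 + g) ^+ m by rewrite exprn_gt0 // addr_gt0.
rewrite -(ler_pM2r p2) -exprMn.
have -> : (1 - g) * (1 + g) = 1 - g ^+ 2 by ring.
apply: le_trans (_ : 1 <= _).
  by apply: exprn_ile1; [rewrite subr_ge0 expr_le1 // ltW|rewrite lerBlDr lerDl sqr_ge0].
by lra.
Qed.

(** * The Glauber chain: symmetry and stationarity *)

Section Mixing.
Variables (K : realFieldType) (E : finType) (k : nat) (adj : rel E).
Notation coloring := {ffun E -> 'I_k}.
Implicit Types (f : coloring -> K) (x y z : coloring) (e g : E) (a : 'I_k) (p q : E * 'I_k).
Hypothesis adj_sym : symmetric adj.
Hypothesis adj_irr : irreflexive adj.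

Notation proper_col := (proper_col adj).
Notation mv x p := (update adj x p.1 p.2).
Notation Omega := [set x : coloring | proper_col x].

Definition kernel x y : K :=
  #|[set p : E * 'I_k | mv x p == y]|%:R / (#|E| * k)%:R.

Fixpoint dist x (t : nat) : coloring -> K :=
  if t is t'.+1 then fun y => \sum_z dist x t' z * kernel z y else fun y => (y == x)%:R.

Definition unif y : K := (proper_col y)%:R / #|Omega|%:R.

Definition tv (m n : coloring -> K) : K := 2^-1 * \sum_y `|m y - n y|.

(** A proposal turning [x] into a different [y] is determined by its edge, and proposing the old
    colour of that edge undoes it. *)
Lemma card_updates_le x y : proper_col x ->
  (#|[set p : E * 'I_k | mv x p == y]| <= #|[set p : E * 'I_k | mv y p == x]|)%N.
Proof.
move=> px; have [->//|xy] := eqVneq x y.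
have chg p : mv x p = y -> [/\ y p.1 = p.2, forall g, g != p.1 -> y g = x g & x p.1 != y p.1].
  move=> Ey; have out g : g != p.1 -> y g = x g by move=> fp; rewrite -Ey update_other.
  have ne : x p.1 != y p.1.
    apply: contraNneq xy => E1; apply/eqP/ffunP=> g.
    by have [->//|/out->] := eqVneq g p.1.
  split=> //; move: ne; rewrite -Ey /update; case: ifP => _; last by rewrite eqxx.
  by rewrite recol_eq.
have inj : {in [set p | mv x p == y] &, injective (fun p => (p.1, x p.1))}.
  move=> p q; rewrite !inE => /eqP/chg[yp _ _] /eqP/chg[yq _ _] [E1 _].
  by case: p q yp yq E1 => [e a] [e' a'] /= <- <- ->.
rewrite -(card_in_imset inj); apply/subset_leq_card/subsetP => q /imsetP[p].
rewrite !inE => /eqP Ey ->; apply/eqP.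
by rewrite /= -Ey update_back.
Qed.

Lemma card_updates_sym x y : proper_col x -> proper_col y ->
  #|[set p : E * 'I_k | mv x p == y]| = #|[set p : E * 'I_k | mv y p == x]|.
Proof. by move=> px py; apply/eqP; rewrite eqn_leq !card_updates_le. Qed.

Lemma kernel_sym x y : proper_col x -> proper_col y -> kernel x y = kernel y x.
Proof. by move=> px py; rewrite /kernel card_updates_sym. Qed.

Lemma sum_kernel x f : \sum_y f y * kernel x y = (#|E| * k)%:R^-1 * \sum_p f (mv x p).
Proof.
rewrite (partition_big (fun p => mv x p) predT) //= mulr_sumr; apply: eq_bigr => y _.
rewrite (eq_bigr (fun=> f y)) => [|p /eqP-> //].
rewrite sumr_const -[f y *+ _]mulr_natr /kernel mulrA mulrC; congr (_ * (_ * _%:R)).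
by apply: eq_card => p; rewrite inE.
Qed.

Hypothesis E_gt0 : (0 < #|E|)%N.
Hypothesis k_gt0 : (0 < k)%N.
Let total : K := (#|E| * k)%:R.
Let total_gt0 : 0 < total. Proof. by rewrite ltr0n muln_gt0 E_gt0. Qed.

Lemma kernel_out x y : proper_col x -> ~~ proper_col y -> kernel x y = 0.
Proof.
move=> px npy; rewrite /kernel (_ : [set p | _] = set0) ?cards0 ?mul0r //.
apply/setP=> p; rewrite !inE; apply: contraNF npy => /eqP <-; exact: update_proper.
Qed.

(** Invariance of the uniform distribution on proper colourings: [kernel] is symmetric there and its
    rows sum to 1. *)
Lemma sum_update f : \sum_(x | proper_col x) \sum_p f (mv x p) = total * \sum_(x | proper_col x) f x.
Proof.
transitivity (\sum_(x | proper_col x) total * \sum_(y | proper_col y) f y * kernel y x).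
  apply: eq_bigr => x px; rewrite -[LHS](mulVKf (lt0r_neq0 total_gt0)) -sum_kernel; congr (_ * _).
  rewrite (bigID proper_col) /= [X in _ + X]big1 ?addr0 => [|y npy].
    by apply: eq_bigr => y py; rewrite kernel_sym.
  by rewrite kernel_out // mulr0.
rewrite -mulr_sumr exchange_big /=; congr (_ * _); apply: eq_bigr => y py.
rewrite -mulr_sumr -[RHS]mulr1; congr (_ * _).
transitivity (\sum_x 1 * kernel y x).
  rewrite [RHS](bigID proper_col) /= [X in _ = _ + X]big1 ?addr0 => [|x npx].
    by apply: eq_bigr => x _; rewrite mul1r.
  by rewrite kernel_out // mulr0.
rewrite (sum_kernel y (fun=> 1)) sumr_const card_prod card_ord mulVf ?lt0r_neq0 //.
Qed.

Lemma dist_out x t y : proper_col x -> ~~ proper_col y -> dist x t y = 0.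
Proof.
move=> px; elim: t y => [|t IH] y npy /=.
  by case: eqP npy => // ->; rewrite px.
apply: big1 => z _; have [pz|npz] := boolP (proper_col z).
  by rewrite kernel_out // mulr0.
by rewrite IH // mul0r.
Qed.

Lemma distS x t y : proper_col x -> proper_col y ->
  dist x t.+1 y = total^-1 * \sum_p dist x t (mv y p).
Proof.
move=> px py; rewrite -sum_kernel /=; apply: eq_bigr => z _.
have [pz|npz] := boolP (proper_col z); first by rewrite kernel_sym.
by rewrite dist_out // !mul0r.
Qed.

Lemma sum_dist x t : proper_col x -> \sum_(y | proper_col y) dist x t y = 1.
Proof.
move=> px; elim: t => [|t IH].
  by rewrite (bigD1 x) //= eqxx big1 ?addr0 // => y /andP[_ /negPf->].
rewrite (eq_bigr (fun y => total^-1 * \sum_p dist x t (mv y p))) => [|y py]; last exact: distS.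
by rewrite -mulr_sumr sum_update mulKf ?lt0r_neq0.
Qed.

(** * Total variation from a Poincare inequality *)

Section Spectral.
Variable A : nat.
Hypothesis A_gt0 : (0 < A)%N.
Hypothesis poinc : forall f, var f Omega <= A%:R * dirichlet adj f.

(** By [sqr_avg_le] a step removes #|E| / (2 (#|E| k)^2) times the Dirichlet form, hence at least
    the fraction 1 / (2 #|E| k^2 A) of the variance. *)
Definition relax : nat := 2 * #|E| * k ^ 2 * A.

(* A proposal (e, y e) keeps y, so each y stays put with #|E| of the proposals;
   this laziness turns the Dirichlet form into a decrease of the second moment. *)
Lemma sqr_avg_le f y : proper_col y ->
  (total^-1 * \sum_p f (mv y p)) ^+ 2 <=
  total^-1 * \sum_p f (mv y p) ^+ 2 - #|E|%:R / (2 * total ^+ 2) * local_energy adj f y.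
Proof.
move=> py.
have cardT : #|[set: E * 'I_k]|%:R = total by rewrite cardsT card_prod card_ord.
have sumT (g : E * 'I_k -> K) : \sum_p g p = \sum_(p in [set: E * 'I_k]) g p.
  by apply: eq_bigl => p; rewrite inE.
have := sum_sqr_diff [set: E * 'I_k] (fun p => f (mv y p)).
rewrite cardT => Eq.
have low : #|E|%:R * local_energy adj f y <=
    \sum_(p in [set: E * 'I_k]) \sum_(q in [set: E * 'I_k]) (f (mv y p) - f (mv y q)) ^+ 2.
  rewrite /local_energy pair_big /= mulr_sumr sumT.
  apply: ler_sum => p _; rewrite -sumT.
  rewrite (eq_bigr (fun q => (f (mv y p) - f (mv y (q.1, q.2))) ^+ 2)) => [|[]//].
  rewrite -(pair_bigA _ (fun e a => (f (mv y p) - f (mv y (e, a))) ^+ 2)) /=.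
  rewrite mulr_natl -sumr_const; apply: ler_sum => e _.
  rewrite (bigD1 (y e)) //= update_self // -sqrrN opprB lerDl; apply: sumr_ge0 => a _; exact: sqr_ge0.
rewrite Eq -!sumT in low; set S2 := \sum_p _ in low *; set S := \sum_p _ in low *.
have -> : (total^-1 * S) ^+ 2 = S ^+ 2 / total ^+ 2 by rewrite exprMn exprVn mulrC.
set W := local_energy adj f y in low *.
have scale (a b c d : K) : d != 0 ->
    d^-1 * a - b / (2 * d ^+ 2) * c = (d * a - b * c / 2) / d ^+ 2.
  by move=> d0; field.
rewrite scale ?lt0r_neq0 //.
rewrite ler_pM2r ?invr_gt0 ?exprn_gt0 //; lra.
Qed.

Lemma var_distS x t : proper_col x ->
  var (dist x t.+1) Omega <= (1 - relax%:R^-1) * var (dist x t) Omega.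
Proof.
move=> px.
have inO (g : coloring -> K) : \sum_(y in Omega) g y = \sum_(y | proper_col y) g y.
  by apply: eq_bigl => y; rewrite inE.
have := poinc (dist x t); rewrite /var !inO !sum_dist //; set D := dirichlet _ _.
set S := \sum_(y | _) dist x t y ^+ 2; set S' := \sum_(y | _) dist x t.+1 y ^+ 2.
set u := 1 ^+ 2 / _ => PI.
have le1 : S' <= S - #|E|%:R / (2 * total ^+ 2) * D.
  apply: le_trans (_ : \sum_(y | proper_col y) (total^-1 * \sum_p dist x t (mv y p) ^+ 2
    - #|E|%:R / (2 * total ^+ 2) * local_energy adj (dist x t) y) <= _).
    by apply: ler_sum => y py; rewrite distS //; apply: sqr_avg_le.
  rewrite sumrB -!mulr_sumr (sum_update (fun y => dist x t y ^+ 2)) mulKf ?lt0r_neq0 //.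
have E0 : 0 < #|E|%:R :> K by rewrite ltr0n.
have k0 : 0 < k%:R :> K by rewrite ltr0n.
have A0 : 0 < A%:R :> K by rewrite ltr0n.
have -> : (1 - relax%:R^-1) * (S - u) = S - u - (S - u) / relax%:R by ring.
suff : (S - u) / relax%:R <= #|E|%:R / (2 * total ^+ 2) * D by lra.
rewrite ler_pdivrMr; last by rewrite ltr0n /relax !muln_gt0 E_gt0 k_gt0 A_gt0.
apply: le_trans PI _; rewrite /relax /total !natrM.
rewrite le_eqVlt; apply/orP; left; apply/eqP; field.
by rewrite !lt0r_neq0.
Qed.

(** Cauchy-Schwarz; [#|Omega|] times the variance is the chi-square distance to uniform. *)
Lemma tv_sqr_le x t : proper_col x ->
  tv (dist x t) unif ^+ 2 <= 4^-1 * (#|Omega|%:R * var (dist x t) Omega).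
Proof.
move=> px.
have inO (g : coloring -> K) : \sum_(y in Omega) g y = \sum_(y | proper_col y) g y.
  by apply: eq_bigl => y; rewrite inE.
have O0 : 0 < #|Omega|%:R :> K by rewrite ltr0n card_gt0; apply/set0Pn; exists x; rewrite inE.
rewrite /tv exprMn.
have -> : 2^-1 ^+ 2 = 4^-1 :> K by field.
rewrite ler_pM2l ?invr_gt0 ?ltr0n //.
have -> : \sum_y `|dist x t y - unif y| = \sum_(y in Omega) `|dist x t y - #|Omega|%:R^-1|.
  rewrite inO (bigID proper_col) /= [X in _ + X]big1 ?addr0 => [|y npy].
    by apply: eq_bigr => y py; rewrite /unif py mul1r.
  by rewrite dist_out // /unif (negPf npy) mul0r subrr normr0.
apply: le_trans (sqr_sum_leq _ _) _; rewrite ler_pM2l //.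
rewrite (eq_bigr (fun y => dist x t y ^+ 2 + (#|Omega|%:R^-1 ^+ 2
    - 2 * #|Omega|%:R^-1 * dist x t y))) => [|y _]; last first.
  by rewrite real_normK ?num_real //; ring.
rewrite big_split /= sumrB sumr_const -mulr_sumr inO !inO sum_dist // /var !inO sum_dist //.
rewrite -[_ *+ _]mulr_natr lerD2l le_eqVlt; apply/orP; left; apply/eqP.
by field; rewrite lt0r_neq0.
Qed.

Lemma var_dist x t : proper_col x -> var (dist x t) Omega <= (1 - relax%:R^-1) ^+ t.
Proof.
move=> px; elim: t => [|t IH].
  rewrite expr0 /var (bigD1 x) ?inE //= eqxx expr1n big1 ?addr0.
    by rewrite gerDl oppr_le0 divr_ge0 ?sqr_ge0.
  by move=> y /andP[_ /negPf->]; rewrite expr0n.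
apply: le_trans (var_distS t px) _; rewrite exprS ler_wpM2l //.
rewrite subr_ge0 invf_le1 ?ler1n ?ltr0n /relax !muln_gt0 E_gt0 k_gt0 A_gt0 //.
Qed.

Lemma spectral_mixing x : proper_col x -> tv (dist x (relax * (k * #|E| + 3))) unif < 4^-1.
Proof.
(* Of the [s] halvings, k #|E| cancel the crude bound [#|Omega|] <= 2^(k #|E|), and three more bring
   the squared distance to 1/32 < 1/16. *)
move=> px; set s := (k * #|E| + 3)%N; set t := (relax * s)%N.
have tv0 : 0 <= tv (dist x t) unif.
  by rewrite mulr_ge0 ?invr_ge0 ?ler0n //; apply: sumr_ge0 => y _; apply: normr_ge0.
rewrite -(@ltr_pXn2r _ 2) ?nnegrE ?invr_ge0 ?ler0n //.
apply: le_lt_trans (tv_sqr_le t px) _.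
have r0 : (0 < relax)%N by rewrite /relax !muln_gt0 E_gt0 k_gt0 A_gt0.
have O2 : #|Omega|%:R <= 2 ^+ (k * #|E|) :> K.
  rewrite -natrX ler_nat; apply: leq_trans (max_card _) _.
  rewrite card_ffun card_ord expnM leq_exp2r //; exact/ltnW/ltn_expl.
have v1 : var (dist x t) Omega <= 2^-1 ^+ s.
  apply: le_trans (var_dist t px) _; rewrite /t exprM; apply: lerXn2r; rewrite ?nnegrE ?invr_ge0 ?ler0n //.
    by rewrite exprn_ge0 // subr_ge0 invf_le1 ?ler1n ?ltr0n.
  exact: expr_half.
have : #|Omega|%:R * var (dist x t) Omega <= 2 ^+ (k * #|E|) * 2^-1 ^+ s.
  apply: le_trans (_ : #|Omega|%:R * 2^-1 ^+ s <= _); first by rewrite ler_wpM2l.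
  by rewrite ler_wpM2r // exprn_ge0 // invr_ge0 ler0n.
rewrite /s exprD mulrA -exprMn divff ?expr1n ?mul1r ?pnatr_eq0 // => W.
have -> : 4^-1 ^+ 2 = 4^-1 * 4^-1 :> K by rewrite expr2.
rewrite ltr_pM2l ?invr_gt0 ?ltr0n //; apply: le_lt_trans W _.
by rewrite -subr_gt0; have -> : 4^-1 - 2^-1 ^+ 3 = 8^-1 :> K; [field|rewrite invr_gt0 ltr0n].
Qed.

End Spectral.

(** * Contraction of the Hamming distance when colours are plentiful *)

Section Contraction.
Hypothesis k_large : (8 * #|E| <= k)%N.

Definition hamming x y : nat := #|[set g | x g != y g]|.

Lemma hammingE x y : hamming x y = (\sum_g (x g != y g))%N.
Proof. by rewrite /hamming -sum1dep_card big_mkcond. Qed.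

Lemma update_atE x g a : update adj x g a g =
  if [forall f, adj f g ==> (x f != a)] then a else x g.
Proof. by rewrite /update; case: ifP => _ //; rewrite recol_eq. Qed.

(** If [x] and [y] differ at [g], only colours occurring in [x] or [y] can leave a difference; if
    they agree there, only colours on edges where they differ can create one. *)
Lemma disagree_at x y g :
  (\sum_a (update adj x g a g != update adj y g a g) <= 2 * #|E| * (x g != y g) + 2 * hamming x y)%N.
Proof.
have card_two (D : {set E}) : (#|[set x e | e in D] :|: [set y e | e in D]| <= 2 * #|D|)%N.
  by rewrite mul2n -addnn (leq_trans (leq_card_setU _ _)) // leq_add ?leq_imset_card.
have cover (D : {set E}) : (forall a, a \notin [set x e | e in D] :|: [set y e | e in D] ->
    update adj x g a g = update adj y g a g) ->
    (\sum_a (update adj x g a g != update adj y g a g) <= 2 * #|D|)%N.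
  move=> eqD; apply: leq_trans (card_two D); rewrite -sum1_card big_mkcond [X in (_ <= X)%N]big_mkcond.
  apply: leq_sum => a _; have [//|/eqD ->] := boolP (a \in _); last by rewrite eqxx.
  by case: (_ != _).
have [Eg|neg] := eqVneq (x g) (y g); last first.
  rewrite muln1; apply: leq_trans (leq_addr _ _); rewrite -cardsT; apply: cover => a.
  rewrite inE negb_or => /andP[nx ny]; rewrite !update_atE.
  have -> : [forall f, adj f g ==> (x f != a)].
    by apply/forallP=> f; apply/implyP=> _; apply: contraNneq nx => <-; apply: imset_f.
  suff -> : [forall f, adj f g ==> (y f != a)] by [].
  by apply/forallP=> f; apply/implyP=> _; apply: contraNneq ny => <-; apply: imset_f.
rewrite muln0 add0n; apply: cover => a; rewrite inE negb_or => /andP[nx ny]; rewrite !update_atE Eg.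
congr (if _ then _ else _); apply/eq_forallb => f.
have [->//|nf] := eqVneq (x f) (y f).
have -> : x f != a by apply: contraNneq nx => <-; apply: imset_f; rewrite inE.
by have -> : y f != a by apply: contraNneq ny => <-; apply: imset_f; rewrite inE.
Qed.

(** Proposals at other edges leave [g] alone, so the sum is at most 4 N d + (N - 1) k d; the
    hypothesis 8 N <= k makes 4 N d at most k d / 2. *)
Lemma updates_hamming x y :
  (2 * \sum_p hamming (mv x p) (mv y p) <= (2 * #|E| - 1) * k * hamming x y)%N.
Proof.
set N := #|E|; set d := hamming x y.
have -> : (\sum_p hamming (mv x p) (mv y p) =
    \sum_g \sum_e \sum_a (update adj x e a g != update adj y e a g))%N.
  under eq_bigr => p _ do rewrite hammingE.
  by rewrite exchange_big; apply: eq_bigr => g _; rewrite pair_bigA.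
apply: leq_trans (_ : 2 * \sum_g (2 * N * (x g != y g) + 2 * d + (N - 1) * k * (x g != y g)) <= _)%N.
  rewrite leq_mul2l; apply: leq_sum => g _; rewrite (bigD1 g) //= leq_add ?disagree_at //.
  rewrite (eq_bigr (fun=> k * (x g != y g))%N) => [|e ne]; last first.
    rewrite (eq_bigr (fun=> (x g != y g) : nat)) => [|a _]; last by rewrite !update_other // eq_sym.
    by rewrite sum_nat_const card_ord.
  by rewrite sum_nat_const cardC1 -subn1 mulnA.
rewrite !big_split /= -!big_distrr /= -hammingE -/d sum_nat_const -/N.
have : (8 * N * d <= k * d)%N by rewrite leq_mul2r k_large orbT.
have N0 : (0 < N)%N by [].
case: N N0 => // n _; rewrite subn1 /=.
by rewrite big1_eq; nia.
Qed.

(** Dual form of the coupling: Lipschitz constants of test functions are followed under [avg], and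
    no joint distribution has to be built. *)
Definition lipschitz (L : K) f := forall x y, `|f x - f y| <= L * (hamming x y)%:R.

Definition avg f x : K := total^-1 * \sum_p f (mv x p).

Lemma avg_lipschitz L f : 0 <= L -> lipschitz L f ->
  lipschitz ((1 - (2 * #|E|)%:R^-1) * L) (avg f).
Proof.
move=> L0 lf x y; have K1 : 0 <= total^-1 by rewrite invr_ge0 ltW.
rewrite /avg -mulrBr -sumrB normrM (ger0_norm K1) mulrC ler_pdivrMr //.
rewrite [X in _ <= X]mulrC; apply: le_trans (ler_norm_sum _ _ _) _.
apply: le_trans (ler_sum _ (fun p _ => lf (mv x p) (mv y p))) _.
rewrite -mulr_sumr -natr_sum.
have := updates_hamming x y; rewrite -(ler_nat K) !natrM.
set S := (\sum_p _)%N; set d := hamming x y => Hd.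
have N0 : 0 < #|E|%:R :> K by rewrite ltr0n.
rewrite natrB ?muln_gt0 ?E_gt0 // natrM in Hd.
have -> : total * ((1 - (2 * #|E|%:R)^-1) * L * d%:R) = L * ((2 * #|E|%:R - 1) * k%:R * d%:R / 2).
  by rewrite /total natrM; field; rewrite lt0r_neq0.
rewrite ler_wpM2l //; lra.
Qed.

Definition expect x t f := \sum_y dist x t y * f y.

Lemma expectS x t f : expect x t.+1 f = expect x t (avg f).
Proof.
rewrite /expect /=; under eq_bigr => y _ do rewrite mulr_suml.
rewrite exchange_big; apply: eq_bigr => z _; rewrite /avg -sum_kernel mulr_sumr.
by apply: eq_bigr => y _; rewrite mulrA mulrAC -mulrA.
Qed.

Lemma expect_lipschitz L f t : 0 <= L -> lipschitz L f ->
  lipschitz ((1 - (2 * #|E|)%:R^-1) ^+ t * L) (fun x => expect x t f).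
Proof.
have c0 : 0 <= 1 - (2 * #|E|)%:R^-1 :> K.
  by rewrite subr_ge0 invf_le1 ?ler1n ?ltr0n ?muln_gt0 ?E_gt0.
elim: t f L => [|t IH] f L L0 lf x y.
  have E0 z : expect z 0 f = f z.
    by rewrite /expect (bigD1 z) //= eqxx mul1r big1 ?addr0 // => w /negPf->; rewrite mul0r.
  by rewrite !E0 expr0 mul1r.
rewrite !expectS exprSr -mulrA; apply: IH; first by rewrite mulr_ge0.
exact: avg_lipschitz.
Qed.

Lemma expect_stationary t f :
  \sum_(x | proper_col x) expect x t f = \sum_(x | proper_col x) f x.
Proof.
elim: t f => [|t IH] f.
  apply: eq_bigr => z _.
  by rewrite /expect (bigD1 z) //= eqxx mul1r big1 ?addr0 // => w /negPf->; rewrite mul0r.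
under eq_bigr => x _ do rewrite expectS.
by rewrite IH /avg -mulr_sumr sum_update mulKf ?lt0r_neq0.
Qed.

(** The sign of the discrepancy, a 2-Lipschitz test function, turns the l1 distance into a
    difference of expectations; stationarity writes the uniform one as an average over starting
    points. *)
Lemma contraction_tv x t : proper_col x ->
  tv (dist x t) unif <= (1 - (2 * #|E|)%:R^-1) ^+ t * #|E|%:R.
Proof.
move=> px; set rho := 1 - _; pose s y : K := Num.sg (dist x t y - unif y).
have rho0 : 0 <= rho by rewrite subr_ge0 invf_le1 ?ler1n ?ltr0n ?muln_gt0 ?E_gt0.
have O0 : 0 < #|Omega|%:R :> K by rewrite ltr0n card_gt0; apply/set0Pn; exists x; rewrite inE.
have s_le1 y : `|s y| <= 1 by rewrite /s normr_sg lern1 leq_b1.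
have ls : lipschitz 2 s.
  move=> y z; have [->|nyz] := eqVneq y z; first by rewrite subrr normr0 mulr_ge0.
  apply: le_trans (ler_normB _ _) _; apply: le_trans (_ : 2 <= _).
    by rewrite -[2]/(1 + 1) lerD.
  rewrite ler_peMr // ler1n card_gt0; apply: contraNneq nyz => d0; apply/eqP/ffunP=> g.
  by apply/eqP; move/setP: d0 => /(_ g); rewrite !inE => /negbFE.
have le2 : \sum_y `|dist x t y - unif y| <= rho ^+ t * 2 * #|E|%:R.
  have -> : \sum_y `|dist x t y - unif y| = expect x t s - \sum_y unif y * s y.
    rewrite /expect -sumrB; apply: eq_bigr => y _; rewrite -mulrBl /s.
    by rewrite [RHS]mulrC -normrEsg.
  have -> : \sum_y unif y * s y = #|Omega|%:R^-1 * \sum_(y | proper_col y) expect y t s.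
    rewrite expect_stationary mulr_sumr [RHS]big_mkcond; apply: eq_bigr => y _.
    by rewrite /unif; case: ifP => _; rewrite ?mul1r // !mul0r.
  have sumO (c : K) : \sum_(y : coloring | proper_col y) c = #|Omega|%:R * c.
    rewrite (eq_bigl (mem Omega)) => [|y]; last by rewrite /= inE.
    by rewrite sumr_const mulr_natl.
  rewrite -[expect x t s](mulKf (lt0r_neq0 O0)) -sumO -mulrBr -sumrB mulrC ler_pdivrMr //.
  rewrite mulrC -sumO.
  apply: ler_sum => y _; apply: le_trans (ler_norm _) _.
  apply: le_trans (expect_lipschitz t _ ls x y) _ => //.
  by rewrite ler_wpM2l ?mulr_ge0 ?exprn_ge0 // ler_nat max_card.
rewrite /tv; lra.
Qed.

(** #|E| halvings absorb the factor #|E|, and three more leave 1/8. *)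
Lemma contraction_mixing x : proper_col x ->
  tv (dist x (2 * #|E| * (#|E| + 3))) unif < 4^-1.
Proof.
move=> px; apply: le_lt_trans (contraction_tv _ px) _; rewrite exprM.
have N0 : (0 < 2 * #|E|)%N by rewrite muln_gt0 E_gt0.
apply: le_lt_trans (_ : 2^-1 ^+ (#|E| + 3) * #|E|%:R < _).
  rewrite ler_wpM2r //; apply: lerXn2r; rewrite ?nnegrE ?invr_ge0 ?ler0n //; last exact: expr_half.
  by rewrite exprn_ge0 // subr_ge0 invf_le1 ?ler1n ?ltr0n.
rewrite exprD -mulrA mulrC -mulrA.
have l1 : #|E|%:R * 2^-1 ^+ #|E| <= 1 :> K.
  rewrite exprVn ler_pdivrMr ?exprn_gt0 // mul1r -natrX ler_nat; exact/ltnW/ltn_expl.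
have -> : 2^-1 ^+ 3 = 8^-1 :> K by field.
lra.
Qed.

End Contraction.

End Mixing.

(** * Rooting the tree and orienting its edges *)

Section RootedTree.
Local Open Scope nat_scope.
Variables (n : nat) (T : rel 'I_n) (r : 'I_n).
Hypothesis treeT : is_tree T.
Implicit Types (x y z v w : 'I_n).

Let T_sym : symmetric T. Proof. by case: treeT => [[]]. Qed.
Let T_irr : irreflexive T. Proof. by case: treeT => [[]]. Qed.
Let T_acyclic : acyclic T. Proof. by case: treeT. Qed.

(** Tuples of fixed length make this a boolean, so that [ex_minn] can extract the distance to the
    root. *)
Definition reach x m := [exists p : m.-tuple 'I_n, path T r p && (last r p == x)].

Lemma reachP x m : reflect (exists p, [/\ path T r p, last r p = x & size p = m]) (reach x m).
Proof.
apply: (iffP existsP) => [[p /andP[rp /eqP lp]]|[p [rp lp sp]]].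
  by exists p; rewrite size_tuple.
have sp' : size p == m by apply/eqP.
by exists (Tuple sp'); rewrite /= rp lp eqxx.
Qed.

Lemma reach_ex x : exists m, reach x m.
Proof.
case: treeT => _ con _; have /connectP[p rp ->] := con r x.
by exists (size p); apply/reachP; exists p.
Qed.

Definition depth x := ex_minn (reach_ex x).

Lemma depth_path x : exists p, [/\ path T r p, last r p = x & size p = depth x].
Proof. by rewrite /depth; case: ex_minnP => m /reachP. Qed.

Lemma depth_le p : path T r p -> depth (last r p) <= size p.
Proof. by move=> rp; rewrite /depth; case: ex_minnP => m _; apply; apply/reachP; exists p. Qed.

Lemma depth_adj x y : T x y -> depth y <= (depth x).+1.
Proof.
move=> xy; have [p [rp lp <-]] := depth_path x.
have := @depth_le (rcons p y); rewrite rcons_path last_rcons size_rcons lp rp; exact.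
Qed.

Lemma depth0 x : depth x = 0 -> x = r.
Proof. by move=> d0; have [p [_ lp]] := depth_path x; rewrite d0 => /size0nil p0; rewrite -lp p0. Qed.

Lemma depth_pred x : 0 < depth x -> exists2 y, T x y & depth x = (depth y).+1.
Proof.
move=> d0; have [p [rp lp sp]] := depth_path x; move: rp lp sp.
case/lastP: p => [|p z]; first by move=> _ _ E0; move: d0; rewrite -E0.
rewrite rcons_path last_rcons size_rcons => /andP[rp pz] zx Ep.
exists (last r p); first by rewrite T_sym -zx.
by apply/eqP; rewrite eqn_leq -{1}zx depth_adj // -Ep ltnS depth_le.
Qed.

(* Two neighbours no deeper than x are joined by a path through shallower
   vertices, hence avoiding x, and would close a cycle with x. *)
Lemma parent_unique x y z : T x y -> T x z -> depth y <= depth x -> depth z <= depth x -> y = z.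
Proof.
move=> xy xz dy dz; pose U : rel 'I_n := [rel a b | [&& T a b, a != x & b != x]].
have U_sym : symmetric U by move=> a b; rewrite /U /= T_sym [(a != x) && _]andbC.
have nx w : T x w -> w != x by apply: contraTneq => ->; rewrite T_irr.
have low m w : depth w <= m -> w != x -> depth w <= depth x -> connect U r w.
  elim: m w => [|m IH] w; first by rewrite leqn0 => /eqP/depth0->; rewrite connect0.
  move=> dm wx dw; have [/depth0->|] := posnP (depth w); first exact: connect0.
  case/depth_pred=> v wv Ew.
  have vx : v != x by apply: contraTneq dw => <-; rewrite Ew ltnn.
  apply: connect_trans (IH v _ vx _) (connect1 _).
  - by rewrite -ltnS -Ew.
  - by apply: leq_trans dw; rewrite Ew.
  - by rewrite /U /= T_sym wv vx.
have ry := low _ y (leqnn _) (nx _ xy) dy; have rz := low _ z (leqnn _) (nx _ xz) dz.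
have : connect U y z by apply: connect_trans rz; rewrite (sym_connect_sym U_sym).
case/connectP=> p0 /shortenP[p yp up _ Ez]; apply/eqP; apply: contraT => nyz.
have px : x \notin p.
  elim: p y yp {up Ez ry low nyz dy xy} => //= a p IH y /andP[/and3P[_ _ ax] ap].
  by rewrite inE eq_sym (negPf ax) (IH a).
have : size (x :: y :: p) < 3.
  apply: T_acyclic; apply/andP; split.
    rewrite /= xy rcons_path -Ez T_sym xz andbT.
    by apply: sub_path yp => a b /andP[].
  by rewrite cons_uniq up andbT inE negb_or eq_sym nx.
by case: p Ez {yp up px} => //= Ez; rewrite Ez eqxx in nyz.
Qed.

(** Away from the root, a neighbour of equal depth would coincide with the neighbour one level up,
    by [parent_unique]. *)
Lemma depth_neq x y : T x y -> depth x <> depth y.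
Proof.
move=> xy Ed; have [/depth0 x0|/depth_pred[w xw Ew]] := posnP (depth x).
  have y0 : y = r by apply: depth0; rewrite -Ed x0; have := @depth_le [::]; rewrite leqn0 => /(_ isT)/eqP.
  by move: xy; rewrite y0 x0 T_irr.
have E1 : y = w by apply: (parent_unique xy xw); rewrite ?Ed // -Ed Ew.
by move: Ew; rewrite -E1 Ed => /eqP; rewrite -[X in X == _]addn0 -addn1 eqn_add2l.
Qed.

Notation E := (edge T).

(** The default is never taken, because adjacent vertices have different depths ([endsP]). *)
Definition ends (e : E) : 'I_n * 'I_n :=
  odflt (r, r) [pick p : 'I_n * 'I_n |
     [&& T p.1 p.2, val e == [set p.1; p.2] & depth p.1 < depth p.2]].
Definition etop e := (ends e).1.
Definition ebot e := (ends e).2.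

Lemma endsP e : [/\ T (etop e) (ebot e), val e = [set etop e; ebot e] &
  depth (ebot e) = (depth (etop e)).+1].
Proof.
have sim p : T p.1 p.2 -> depth p.1 < depth p.2 -> depth p.2 = (depth p.1).+1.
  by move=> Tp dp; apply/eqP; rewrite eqn_leq depth_adj.
rewrite /etop /ebot /ends; case: pickP => [p /and3P[Tp /eqP Ee dp]|N] /=.
  by split=> //; apply: sim.
have := valP e; rewrite inE => /existsP[x /existsP[y /andP[xy /eqP Ee]]].
case: (ltngtP (depth x) (depth y)) => [lt|gt|/(depth_neq xy)//].
  by move: (N (x, y)); rewrite /= xy Ee lt eqxx.
by move: (N (y, x)); rewrite /= T_sym xy Ee gt setUC eqxx.
Qed.

Lemma ebot_inj : injective ebot.
Proof.
move=> e f Eb; have [Te Ve De] := endsP e; have [Tf Vf Df] := endsP f.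
apply: val_inj; rewrite Ve Vf Eb; congr [set _; _].
rewrite -{}Eb in Tf Df.
by apply: (@parent_unique (ebot e)); rewrite 1?T_sym // ?De // -ltnS -?De -?Df.
Qed.

Lemma depth_ebot e : depth (ebot e) = (depth (etop e)).+1.
Proof. by have [] := endsP e. Qed.

Lemma card_star_edge v : #|star etop ebot v| <= deg T v.
Proof.
rewrite -(card_imset _ (@val_inj _ _ E)).
apply: leq_trans (leq_imset_card (fun y => [set v; y]) [set y | T v y]).
apply/subset_leq_card/subsetP => s /imsetP[e sv ->].
have [Te Ve _] := endsP e; rewrite Ve; apply/imsetP.
case/orP: sv => /eqP <-; first by exists (ebot e); rewrite ?inE.
by exists (etop e); rewrite ?inE 1?T_sym // setUC.
Qed.

(** Distinct edges never share their lower ends, which is why [tadj] lists three of the four ways to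
    meet. *)
Lemma edges_adjE : @edges_adj n T = tadj etop ebot.
Proof.
apply/funext=> e; apply/funext=> f; rewrite /edges_adj /tadj; case: eqVneq => //= nef.
have [_ -> _] := endsP e; have [_ -> _] := endsP f.
have nb : ebot e != ebot f by apply: contra_neq nef => /ebot_inj.
apply/set0Pn/or3P => [[v]|].
  rewrite !inE => /andP[/orP[/eqP-> | /eqP->] /orP[/eqP<-|/eqP Eb]].
  - exact: Or31.
  - by rewrite Eb; apply: Or32.
  - exact: Or33.
  - by case/eqP: nb.
case=> /eqP Ev; [exists (etop e)|exists (etop e)|exists (ebot e)];
  by rewrite !inE Ev !eqxx ?orbT.
Qed.

Lemma card_edge_le : #|{: E}| <= n.
Proof. by rewrite -[X in _ <= X]card_ord -(card_imset _ ebot_inj) max_card. Qed.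

End RootedTree.

(** * The explicit exponent and the conclusion *)

(** Since k <= 8 n <= n^3, the factors are at most n^2, n^6, n^4, n^90 and n^5, and the exponents
    add up to 107. *)
Lemma spectral_time_le (n N k : nat) : (3 <= n -> N <= n -> k <= 8 * n ->
  2 * N * k ^ 2 * (N * k * ((1 + N * N * k * k) ^ 5) ^ 2) * (k * N + 3) <= n ^ 107)%N.
Proof.
move=> n3 Nn k8; have n0 : (0 < n)%N by apply: leq_trans n3.
have k3 : (k <= n ^ 3)%N.
  apply: leq_trans k8 _; rewrite expnSr leq_mul2r; apply/orP; right.
  by apply: (@leq_trans (3 ^ 2)) => //; rewrite leq_exp2r.
have up m : (1 + n ^ m.+1 <= n ^ m.+2)%N.
  apply: leq_trans (_ : n ^ m.+1 + n ^ m.+1 <= _)%N; first by rewrite leq_add2r expn_gt0 n0.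
  by rewrite addnn -mul2n [X in (_ <= X)%N]expnS leq_mul2r (ltnW n3) orbT.
have b1 : (1 + N * N * k * k <= n ^ 9)%N.
  apply: leq_trans (up 7); rewrite leq_add2l.
  apply: leq_trans (_ : n * n * n ^ 3 * n ^ 3 <= _)%N; first by rewrite !leq_mul.
  by rewrite -{1 2}[n]expn1 -!expnD.
have b2 : (((1 + N * N * k * k) ^ 5) ^ 2 <= n ^ 90)%N.
  by rewrite -expnM (_ : (n ^ 90 = (n ^ 9) ^ 10)%N) ?leq_exp2r // -expnM.
have b3 : (k * N + 3 <= n ^ 5)%N.
  apply: leq_trans (_ : n ^ 4 + n ^ 4 <= _)%N.
    apply: leq_add; first by rewrite expnSr leq_mul.
    by apply: leq_trans n3 _; rewrite -{1}[n]expn1 leq_pexp2l.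
  by rewrite addnn -mul2n [X in (_ <= X)%N]expnS leq_mul2r (ltnW n3) orbT.
apply: leq_trans (_ : n * n * (n ^ 3) ^ 2 * (n * n ^ 3 * n ^ 90) * n ^ 5 <= _)%N.
  apply: leq_mul b3; apply: leq_mul; last by apply: leq_mul b2; apply: leq_mul.
  apply: leq_mul; last by rewrite leq_exp2r.
  by apply: leq_mul => //; apply: ltnW.
by rewrite -{1 2 4}[n]expn1 -expnM -!expnD leq_pexp2l.
Qed.

Lemma mixing_time_tree (n : nat) (T : rel 'I_n) (k : nat) :
  is_tree T -> (3 <= max_degree T)%N -> (max_degree T + 1 <= k)%N ->
  exists2 t : nat, mixed_at T k t & (t <= n ^ 107)%N.
Proof.
move=> treeT deg3 Dk.
have deg_n : (max_degree T <= n)%N.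
  by apply/bigmax_leqP => x _; rewrite -[X in (_ <= X)%N]card_ord max_card.
have n3 : (3 <= n)%N by apply: leq_trans deg_n.
pose r : 'I_n := Ordinal (leq_trans (isT : (0 < 3)%N) n3).
pose E := edge T; pose N := #|{: E}|.
have Nn : (N <= n)%N := card_edge_le r treeT.
have k0 : (0 < k)%N by apply: leq_trans Dk; rewrite addn1.
have N0 : (0 < N)%N.
  have [x dx] : exists x, (0 < deg T x)%N.
    apply/existsP; apply: contraTT deg3 => /existsPn d0; rewrite -ltnNge.
    by rewrite ltnS (leq_trans _ (isT : (0 <= 2)%N)) //; apply/bigmax_leqP => x _; rewrite leqNgt d0.
  move: dx; rewrite card_gt0 => /set0Pn[y]; rewrite inE => xy.
  have eP : [set x; y] \in edge_set T.
    by rewrite inE; apply/existsP; exists x; apply/existsP; exists y; rewrite xy eqxx.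
  by apply/card_gt0P; exists (Sub [set x; y] eP : E).
have star_lt v : (#|star (@etop n T r treeT) (@ebot n T r treeT) v| < k)%N.
  apply: leq_ltn_trans (card_star_edge r treeT v) _.
  by apply: leq_trans Dk; rewrite addn1 ltnS; apply: leq_bigmax.
have sym : symmetric (@edges_adj n T) by rewrite (edges_adjE r treeT); apply: tadj_sym.
have irr : irreflexive (@edges_adj n T) by rewrite (edges_adjE r treeT); apply: tadj_irr.
have [kN|Nk] := leqP (8 * N) k.
  exists (2 * N * (N + 3))%N.
    (* The chain of the statement is, by conversion, the abstract one with adjacency [edges_adj]. *)
    by move=> x px; apply: (@contraction_mixing R E k (@edges_adj n T)).
  apply: leq_trans (_ : n ^ 4 <= _)%N; last by rewrite leq_pexp2l // (leq_trans _ n3).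
  rewrite (_ : (n ^ 4 = (n * n) * (n * n))%N); last by rewrite !expnS expn0 muln1 !mulnA.
  apply: leq_mul; first exact: leq_mul (ltnW n3) Nn.
  apply: leq_trans (_ : n + n <= _)%N; first exact: leq_add.
  by rewrite addnn -mul2n leq_mul2r (ltnW n3) orbT.
pose A := poincare_const E k.
exists (relax E k A * (k * N + 3))%N.
  move=> x px.
  apply: (@spectral_mixing R E k (@edges_adj n T)) => //.
    by rewrite /A /poincare_const /near_count 2!muln_gt0 N0 k0 expn_gt0 expn_gt0.
  move=> f; rewrite (edges_adjE r treeT).
  apply: (poincare (dep := @depth n T r treeT) (H := \max_v @depth n T r treeT v)) => //.
  - exact: ebot_inj.
  - exact: depth_ebot.
  - by move=> v; apply: leq_bigmax.
apply: spectral_time_le => //; apply: leq_trans (ltnW Nk) _.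
by rewrite leq_mul2l Nn.
Qed.

Theorem theorem1 :
  exists C : R, 0 < C /\
    forall (n : nat) (T : rel 'I_n),
      is_tree T -> (3 <= max_degree T)%N ->
      forall k : nat, (max_degree T + 1 <= k)%N ->
        mixing_time_le T k (powR (n%:R : R) C).
Proof.
exists 107%:R; split; first by rewrite ltr0n.
move=> n T treeT deg3 k Dk; have [t mt tn] := mixing_time_tree treeT deg3 Dk.
by exists t; split; rewrite // powR_mulrn ?ler0n // -natrX ler_nat.
Qed.
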